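(* Let $G\subseteq\mathcal H$ be a rational geodesic. For $\Delta>0$ let $\mathrm{CM}^G_\Delta$ denote the set of CM points lying on $G$ whose discriminant $D$ satisfies $|D|\le\Delta$. Then, as $\Delta\to\infty$, $\mathrm{CM}^G_\Delta$ is equidistributed along $G$ with respect to the hyperbolic metric $ds_{\mathrm{hyp}}$; that is, for all compact subarcs (closed bounded intervals) $J_1\subseteq J_2\subseteq G$ such that $J_2$ has nonzero hyperbolic length, $$\lim_{\Delta\to\infty}\frac{\#\,(J_1\cap \mathrm{CM}^G_\Delta)}{\#\,(J_2\cap \mathrm{CM}^G_\Delta)}=\frac{\mathrm{length}_{\mathrm{hyp}}(J_1)}{\mathrm{length}_{\mathrm{hyp}}(J_2)}.$$
   Context: $\mathcal H=\{z=x+iy\in\mathbb C: y>0\}$, with hyperbolic metric $ds_{\mathrm{hyp}}=\sqrt{dx^2+dy^2}/y$. Geodesics in $\mathcal H$ are the vertical half-lines $G_x=\{x+iy: y\in(0,\infty)\}$ ($x\in\mathbb R$) and the semicircles $G_{q,r}=\{q+re^{i\theta}:\theta\in(0,\pi)\}$ ($q\in\mathbb R$, $r>0$). On $G_x$ (parametrized by $y$) the metric restricts to $ds_{\mathrm{hyp}}=\frac1y\,dy$; on $G_{q,r}$ (parametrized by $\theta$) it restricts to $ds_{\mathrm{hyp}}=\frac{1}{\sin\theta}\,d\theta$. A geodesic $G_x$ is rational if $x\in\mathbb Q$; a geodesic $G_{q,r}$ is rational if $q\in\mathbb Q$ and $r^2\in\mathbb Q$. A binary quadratic form is an integer triple $(a,b,c)$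 (standing for $ax^2+bxy+cy^2$), with discriminant $b^2-4ac$; it is normalized if $\gcd(a,b,c)=1$ and the first nonzero entry of $(a,b,c)$ is positive. A CM point is the root in $\mathcal H$ of $az^2+bz+c$, where $(a,b,c)$ is a normalized binary quadratic form of negative discriminant; its discriminant is $b^2-4ac$. (CM points correspond bijectively to such forms.) *)

(* Defs.v *)
From HB Require Import structures.
From mathcomp Require Import all_boot all_order all_algebra.
From mathcomp Require Import finmap.
From mathcomp Require Import all_classical all_reals all_analysis.
From mathcomp Require Import complex.
From mathcomp Require Import ring lra zify.

Set Implicit Arguments.
Unset Strict Implicit.
Unset Printing Implicit Defensive.

Import Order.TTheory GRing.Theory Num.Theory.
Import numFieldNormedType.Exports.

Local Open Scope classical_set_scope.
Local Open Scope complex_scope.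
Local Open Scope ring_scope.

Section HalfPlane.
Variable R : realType.
Implicit Types (t u v x y : R) (z : R[i]) (J : set R[i]).

Definition halfplane : set R[i] := [set z | 0 < complex.Im z].

Definition hyp_speed (g : R -> R[i]) t : R :=
  Num.sqrt (derive1 (fun s => complex.Re (g s)) t ^+ 2 + derive1 (fun s => complex.Im (g s)) t ^+ 2)
  / complex.Im (g t).

Inductive geodesic : Type :=
| Vertical of R
| Semicircle (q r : R) of 0 < r.

Definition param (G : geodesic) : R -> R[i] :=
  match G with
  | Vertical x => fun y => x +i* y
  | Semicircle q r _ => fun t => q%:C + r%:C * (cos t +i* sin t)
  end.

Definition param_dom (G : geodesic) : set R :=
  match G with
  | Vertical _ => `]0, +oo[
  | Semicircle _ _ _ => `]0, pi[
  end.

Definition geodesic_set (G : geodesic) : set R[i] := param G @` param_dom G.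

Definition rational_geodesic (G : geodesic) : Prop :=
  match G with
  | Vertical x => rational x
  | Semicircle q r _ => rational q /\ rational (r ^+ 2)
  end.

(* The parametrizations are injective on their domains, so this is the
   ds_hyp-length of the part of G lying in J. *)
Definition hyp_length (G : geodesic) J : R :=
  \int[lebesgue_measure]_(t in param_dom G `&` param G @^-1` J)
     hyp_speed (param G) t.

Definition compact_subarc (G : geodesic) J : Prop :=
  exists u v, [/\ u <= v, `[u, v] `<=` param_dom G & J = param G @` `[u, v]].

End HalfPlane.

Record bqf := BQF { qa : int; qb : int; qc : int }.

Definition disc (f : bqf) : int := qb f ^+ 2 - 4 * qa f * qc f.

Definition normalized (f : bqf) : bool :=
  (gcdz (qa f) (gcdz (qb f) (qc f)) == 1) &&
  [|| 0 < qa f, (qa f == 0) && (0 < qb f)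
    | [&& qa f == 0, qb f == 0 & 0 < qc f]].

Section CM.
Variable R : realType.
Implicit Types (z : R[i]) (G : geodesic R) (Delta : R).

Definition CM_point z (D : int) : Prop :=
  exists f : bqf,
    [/\ normalized f, disc f < 0, disc f = D, halfplane z
      & (qa f)%:~R * z ^+ 2 + (qb f)%:~R * z + (qc f)%:~R = 0].

Definition CM G Delta : set R[i] :=
  [set z | geodesic_set G z
         /\ exists2 D : int, CM_point z D & `|D|%:~R <= Delta].

(* fset_set is the empty set on infinite sets; finite_subarc_CM below shows
   that this case does not arise for the counts of CM points on arcs. *)
Definition numpts (A : set R[i]) : R := #|` fset_set A|%:R.

End CM.

Section Facts.
Variable R : realType.
Implicit Types (t u v x y : R) (z : R[i]) (G : geodesic R).

Lemma ReIm_param_circle (q r : R) (r0 : 0 < r) t :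
  param (Semicircle q r0) t = (q + r * cos t) +i* (r * sin t).
Proof. by rewrite /=; simpc. Qed.

Lemma geodesic_halfplane G : geodesic_set G `<=` @halfplane R.
Proof.
case: G => [x|q r r0] z [t /=].
  by rewrite in_itv/= andbT => t0 <-.
rewrite in_itv/= => /andP[t0 tpi] <-; rewrite /halfplane /=; simpc.
by rewrite mulr_gt0 // sin_gt0_pi // t0.
Qed.

Lemma hyp_speed_vertical x y : 0 < y -> hyp_speed (param (Vertical x)) y = y^-1.
Proof.
move=> y0; rewrite /hyp_speed /=.
by rewrite !derive1E derive_cst derive_id expr0n expr1n add0r sqrtr1 mul1r.
Qed.

Lemma hyp_speed_semicircle (q r : R) (r0 : 0 < r) t : 0 < t < pi ->
  hyp_speed (param (Semicircle q r0)) t = (sin t)^-1.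
Proof.
move=> t0; rewrite /hyp_speed.
rewrite (_ : (fun s => complex.Re _) = fun t => q + r * cos t); last first.
  by apply/funext => s; rewrite ReIm_param_circle.
rewrite (_ : (fun s => complex.Im _) = fun t => r * sin t); last first.
  by apply/funext => s; rewrite ReIm_param_circle.
rewrite ReIm_param_circle /= !derive1E.
have -> : 'D_1 (fun t : R => q + r * cos t) t = - r * sin t.
  by apply: derive_val; apply: is_derive_eq; rewrite /GRing.scale/=; ring.
have -> : 'D_1 (fun t : R => r * sin t) t = r * cos t.
  by apply: derive_val; apply: is_derive_eq; rewrite /GRing.scale/=; ring.
have -> : (- r * sin t) ^+ 2 + (r * cos t) ^+ 2 = r ^+ 2.
  by rewrite -[RHS]mulr1 -(cos2Dsin2 t); ring.
rewrite sqrtr_sqr gtr0_norm //; have s0 := sin_gt0_pi t0.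
by field; rewrite !gt_eqF.
Qed.

Lemma finite_intz_bounded (N : R) : finite_set [set n : int | `|n%:~R| <= N].
Proof.
have [k Nk] : exists k : nat, N < k%:R.
  by exists (Num.truncn N).+1; rewrite truncnS_gt.
apply: (@sub_finite_set _ _ ((fun m : nat => m%:Z - k%:Z) @` `I_(k + k).+1)).
  move=> n /= nN.
  have {nN} : (`|n|%:~R : R) < k%:Z%:~R.
    by rewrite intr_norm (le_lt_trans nN).
  rewrite ltr_int => nk.
  exists (absz (n + k%:Z)); rewrite ?in_itv /=; lia.
exact/finite_image/finite_II.
Qed.

Lemma CM_coef (f : bqf) x y : 0 < y -> disc f < 0 ->
  (qa f)%:~R * (x +i* y) ^+ 2 + (qb f)%:~R * (x +i* y) + (qc f)%:~R = 0 ->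
  [/\ (qa f)%:~R != 0 :> R, (qb f)%:~R = - (2 * (qa f)%:~R * x),
      (qc f)%:~R = (qa f)%:~R * (x ^+ 2 + y ^+ 2)
    & (disc f)%:~R = - (4 * (qa f)%:~R ^+ 2 * y ^+ 2)].
Proof.
case: f => a b c; rewrite /disc /= => y0 D0.
have intC n : n%:~R = (n%:~R +i* 0 : R[i]) by rewrite -(rmorph_int (real_complex R)).
rewrite !intC expr2; simpc => /eqP; rewrite eq_complex /= => /andP[/eqP Hr /eqP Hi].
have y_neq0 : y != 0 by rewrite gt_eqF.
have Hb : b%:~R = - (2 * a%:~R * x) by apply: (mulIf y_neq0); lra.
have Hc : c%:~R = a%:~R * (x ^+ 2 + y ^+ 2) by move: Hr; rewrite Hb; lra.
have HD : (b ^+ 2 - 4 * a * c)%:~R = - (4 * a%:~R ^+ 2 * y ^+ 2) :> R.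
  by rewrite expr2 !(rmorphB, rmorphM) /= Hb Hc; ring.
split => //; apply/eqP => a0; move: D0.
by rewrite ltNge -(ler_int R) HD a0 expr0n mulr0 mul0r oppr0 lexx.
Qed.

Lemma subarc_bounds G (J : set R[i]) : compact_subarc G J ->
  exists m M : R, 0 < m /\
    forall z, J z -> [/\ m <= complex.Im z, `|complex.Re z| <= M & complex.Im z <= M].
Proof.
case: G => [x|q r r0] [u [v [uv uvG ->]]].
  exists u, (Num.max `|x| v); split.
    have : `]0, +oo[%classic u by apply: uvG; rewrite /= in_itv/= lexx uv.
    by rewrite /= in_itv/= andbT.
  move=> z [t]; rewrite /= in_itv/= => /andP[ut tv] <- /=.
  by rewrite !le_max lexx tv orbT.
have [|t tuv mint] := @EVT_min R (@sin R) u v uv.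
  exact/continuous_subspaceT/continuous_sin.
exists (r * sin t), (`|q| + r); split.
  rewrite mulr_gt0 // sin_gt0_pi //.
  have : `]0, pi[%classic t by exact: uvG.
  by rewrite /= in_itv.
move=> z [s suv <-]; rewrite ReIm_param_circle /=; split.
- by rewrite ler_pM2l // mint.
- rewrite (le_trans (ler_normD _ _)) // lerD2l normrM gtr0_norm //.
  by rewrite ler_piMr ?(ltW r0) // cos_max.
- by rewrite -[leLHS]add0r lerD // ler_piMr ?(ltW r0) //.
Qed.

Lemma finite_subarc_CM G (J : set R[i]) (Delta : R) :
  compact_subarc G J -> finite_set (J `&` CM G Delta).
Proof.
move=> /subarc_bounds[m [M [m0 JM]]].
pose K : R := Delta / (4 * m ^+ 2).
pose I (N : R) := [set n : int | `|n%:~R| <= N].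
pose root (f : int * int * int) : R[i] := let: (a, b, c) := f in
  (- b%:~R / (2 * a%:~R)) +i* Num.sqrt (- (disc (BQF a b c))%:~R / (4 * a%:~R ^+ 2)).
apply: (@sub_finite_set _ _
  (root @` (I K `*` I (2 * K * M) `*` I (K * (M ^+ 2 + M ^+ 2))))); last first.
  by apply/finite_image; do !apply: finite_setX; exact: finite_intz_bounded.
move=> [x y] [/JM[/= my xM yM] [_ [_ [f [_ D0 <- /= y0 fz]] DD]]].
have [a0 Hb Hc HD] := CM_coef y0 D0 fz.
case: f => a b c /= in D0 DD fz a0 Hb Hc HD *.
rewrite /halfplane /= in y0.
have a1 : 1 <= `|a%:~R : R|.
  by rewrite -intr_norm -[leLHS]/(1%:~R) ler_int; move: a0; rewrite intr_eq0; lia.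
have aK : `|a%:~R : R| <= K.
  rewrite ler_pdivlMr ?mulr_gt0 ?exprn_gt0 //; apply: le_trans DD.
  rewrite intr_norm HD; set A : R := a%:~R in a1 *.
  have -> : - (4 * A ^+ 2 * y ^+ 2) = - (4 * (`|A| ^+ 2 * y ^+ 2)).
    by rewrite real_normK ?num_real //; ring.
  rewrite normrN [leRHS]ger0_norm; last by rewrite mulr_ge0 // mulr_ge0 ?sqr_ge0.
  rewrite [leLHS]mulrCA ler_pM2l //.
  rewrite ler_pM ?sqr_ge0 //; first by rewrite expr2 ler_peMr.
  by rewrite ler_sqr ?nnegrE ?(ltW m0) ?(ltW y0).
have K0 : 0 <= K by exact: le_trans aK.
exists (a, b, c) => /=.
  rewrite /I /=; split; [split=> //|].
    by rewrite Hb normrN !normrM normr_nat ler_pM ?mulr_ge0 // ler_pM2l.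
  rewrite Hc normrM ler_pM //.
  rewrite ger0_norm ?addr_ge0 ?sqr_ge0 // lerD //.
    rewrite -(real_normK (num_real x)) ler_sqr ?nnegrE //.
    exact: le_trans xM.
  by rewrite ler_sqr ?nnegrE ?(ltW y0) // (le_trans (ltW y0)).
rewrite HD Hb.
have -> : - - (2 * a%:~R * x) / (2 * a%:~R) = x by field; rewrite a0.
have -> : - - (4 * a%:~R ^+ 2 * y ^+ 2) / (4 * a%:~R ^+ 2) = y ^+ 2.
  by field; rewrite a0.
by rewrite sqrtr_sqr gtr0_norm.
Qed.

End Facts.

(* Main.v *)
(* The integer forms whose root lies on a rational geodesic are those of a rank 2
   lattice, so the CM points on G are the coprime pairs (m, n) with m > 0: the ratio
   n / m gives the position on G, and the discriminant is - m^2 g(n / m) for a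
   quadratic polynomial g. Since ds_hyp = d(n/m) / (k g(n/m)) for a constant k, the
   number of all pairs (m, n) with n / m in an interval and m^2 g(n/m) <= Delta is
   asymptotic to Delta times a constant multiple of the hyperbolic length of the
   corresponding arc. Sorting these pairs by their gcd writes this number as the
   sum over d of the primitive counts at Delta / d^2. As \sum_(d >= 2) 1 / d^2 < 1,
   a bounded function f with \sum_d f(Delta / d^2) / d^2 -> 0 tends to 0, which passes
   from pairs to coprime pairs. *)

Require Import Defs.
From mathcomp Require Import all_boot all_order all_algebra.
From mathcomp Require Import finmap.
From mathcomp Require Import all_classical all_reals all_analysis.
From mathcomp Require Import complex.
From mathcomp Require Import ring lra zify.
Import Order.TTheory GRing.Theory Num.Theory.
Import numFieldNormedType.Exports.
Local Open Scope classical_set_scope.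
Local Open Scope complex_scope.
Local Open Scope ring_scope.

Set Implicit Arguments.
Unset Strict Implicit.
Unset Printing Implicit Defensive.

(** * Counting in boxes *)

Section BoxCount.
Variable R : realType.
Implicit Types (x y a b X : R) (B m n : nat) (phi psi : nat -> nat -> bool).

(** Only ratios of counts are wanted, so the density of coprime pairs is never computed. Let [n1],
    [n2] be the counts of all pairs for the two arcs divided by [T], [A1], [A2] their limits, and
    [p1], [p2] the coprime analogues. Then [A2 * p1 - A1 * p2] has dilation sum [A2 * n1 - A1 * n2],
    which tends to 0, and this is the function that is shown to vanish. Dividing by [p2] requires a
    separate positive lower bound on it. Since the dilations reach arbitrarily small [T / k^2], the
    counts also need a bound linear in [T] for every [T > 0], beside the asymptotics. The region
    [m^2 <= T / g (n / m)] has a curved boundary; it is cut into thin slices of slopes, each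
    squeezed between two triangles, using only that [1 / g] is Lipschitz and that its primitive [H]
    obeys the mean value theorem. Pairs of natural numbers suffice because the chart is translated,
    where necessary, to have nonnegative slope at the left end of the arcs. *)

Definition box_count B phi : R :=
  \sum_(0 <= m < B) \sum_(0 <= n < B) (phi m n)%:R.

Lemma eq_box_count B phi psi : (forall m n, phi m n = psi m n) ->
  box_count B phi = box_count B psi.
Proof.
by move=> e; apply: eq_bigr => m _; apply: eq_bigr => n _; rewrite e.
Qed.

Lemma le_box_count B phi psi : (forall m n, phi m n -> psi m n) ->
  box_count B phi <= box_count B psi.
Proof.
move=> imp; apply: ler_sum => m _; apply: ler_sum => n _.
rewrite ler_nat; have := imp m n.
by case: (phi m n) => // ->.
Qed.

Lemma box_count_ge0 B phi : 0 <= box_count B phi.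
Proof. by do 2 (apply: sumr_ge0 => ? _). Qed.

Lemma box_count_split B phi psi :
  box_count B phi = box_count B (fun m n => phi m n && psi m n)
                  + box_count B (fun m n => phi m n && ~~ psi m n).
Proof.
rewrite -big_split; apply: eq_bigr => m _ /=.
rewrite -big_split; apply: eq_bigr => n _ /=.
by case: (phi m n); case: (psi m n); rewrite /= ?addr0 ?add0r.
Qed.

(** The sum is the ceiling of [x]; [x <= B%:R] ensures that the box cuts nothing off. *)
Lemma below_count x B : 0 <= x -> x <= B%:R ->
  x <= \sum_(0 <= n < B) (n%:R < x)%R%:R < x + 1.
Proof.
move=> x0; elim: B => [|B IH] xB.
  by rewrite big_nil; apply/andP; split; [exact: xB|lra].
rewrite big_nat_recr //=.
have [Bx|xB'] := ltrP B%:R x; last first.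
  by rewrite addr0; exact: IH.
have -> : \sum_(0 <= n < B) (n%:R < x)%R%:R = B%:R :> R.
  transitivity (\sum_(0 <= n < B) 1 : R); last first.
    by rewrite big_const_nat subn0 iter_addr_0.
  rewrite big_nat [RHS]big_nat; apply: eq_bigr => i /andP[_ iB].
  by rewrite (lt_trans _ Bx) // ltr_nat.
rewrite natr1 xB -natr1 /= ltrD2r //.
Qed.

Lemma row_count x y B : 0 <= x -> x <= y -> y <= B%:R ->
  `|\sum_(0 <= n < B) (x <= n%:R < y)%R%:R - (y - x)| <= 1.
Proof.
move=> x0 xy yB.
have /andP[y1 y2] := @below_count y B (le_trans x0 xy) yB.
have /andP[x1 x2] := @below_count x B x0 (le_trans xy yB).
have -> : \sum_(0 <= n < B) (x <= n%:R < y)%R%:R =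
   \sum_(0 <= n < B) (n%:R < y)%R%:R - \sum_(0 <= n < B) (n%:R < x)%R%:R :> R.
  rewrite -sumrB; apply: eq_bigr => n _.
  rewrite leNgt; have [nx|_] := ltrP n%:R x => /=; last by rewrite subr0.
  by rewrite (lt_le_trans nx xy) subrr.
rewrite ler_norml; lra.
Qed.

Lemma sum_le_truncn (F : nat -> R) X B : 0 <= X -> X < B%:R ->
  \sum_(0 <= m < B) (m%:R <= X)%R%:R * F m = \sum_(0 <= m < (Num.truncn X).+1) F m.
Proof.
move=> X0 XB.
have MB : (Num.truncn X < B)%N.
  by rewrite -(ltr_nat R) (le_lt_trans _ XB) // truncn_le.
rewrite (big_cat_nat _ (n := (Num.truncn X).+1)) //= [X in _ + X]big1_seq ?addr0.
  rewrite big_nat [RHS]big_nat; apply: eq_bigr => m /andP[_ mM].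
  by rewrite -truncn_ge_nat // -ltnS mM mul1r.
move=> m; rewrite mem_index_iota => /andP[_ /andP[mM _]].
by rewrite -truncn_ge_nat // leqNgt mM mul0r.
Qed.

Lemma sum_natr M : \sum_(0 <= m < M.+1) m%:R = M%:R * (M%:R + 1) / 2 :> R.
Proof.
elim: M => [|M IH]; first by rewrite big_nat1 mul0r mul0r.
by rewrite big_nat_recr //= IH -natr1; field.
Qed.

Lemma sum_pos M : \sum_(0 <= m < M.+1) (0 < m)%N%:R = M%:R :> R.
Proof.
elim: M => [|M IH]; first by rewrite big_nat1.
by rewrite big_nat_recr //= IH natr1.
Qed.

Definition triangle a b X m n :=
  [&& (0 < m)%N, m%:R <= X & a * m%:R <= n%:R < b * m%:R].

(** Row [m] is a half-open interval of length [D * m], with [D * m + O(1)] integers. Summing up to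
    [M], the floor of [X], gives [D * M * (M + 1) / 2] up to [M], and [M * (M + 1)] is within [X] of
    [X^2] because [M <= X < M + 1]. *)
Lemma triangle_count a b X B : 0 <= a -> a <= b -> 0 <= X -> X < B%:R ->
  b * X <= B%:R ->
  `|box_count B (triangle a b X) - (b - a) * X ^+ 2 / 2| <= ((b - a) / 2 + 1) * X.
Proof.
move=> a0 ab X0 XB bXB; set D := b - a.
have b0 := le_trans a0 ab.
set M := Num.truncn X.
have MX : M%:R <= X by rewrite truncn_le.
have XM : X < M%:R + 1 by rewrite natr1 truncnS_gt.
have M0 : 0 <= M%:R :> R by [].
have D0 : 0 <= D by rewrite subr_ge0.
have H1 : `|box_count B (triangle a b X) - D * (M%:R * (M%:R + 1) / 2)| <= M%:R.
  rewrite -sum_natr mulr_sumr -(sum_le_truncn (fun m => D * m%:R) X0 XB) //.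
  rewrite -sumrB -[leRHS]sum_pos -(sum_le_truncn (fun m => (0 < m)%N%:R) X0 XB) //.
  apply: le_trans (ler_norm_sum _ _ _) _.
  apply: ler_sum => m _; rewrite /triangle.
  have [mX|] := boolP (m%:R <= X); last first.
    rewrite big1 => [|n _]; last by rewrite andbF.
    by rewrite !mul0r subrr normr0.
  have [->|m0] := posnP m.
    by rewrite big1 // !mul1r mulr0 subrr normr0.
  rewrite !mul1r /D mulrBl; apply: row_count.
  - by rewrite mulr_ge0.
  - by rewrite ler_wpM2r.
  - by rewrite (le_trans _ bXB) // ler_wpM2l.
have -> : box_count B (triangle a b X) - D * X ^+ 2 / 2 =
  (box_count B (triangle a b X) - D * (M%:R * (M%:R + 1) / 2))
  + D / 2 * (M%:R * (M%:R + 1) - X ^+ 2) by field.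
apply: le_trans (ler_normD _ _) _.
rewrite [leLHS]addrC [leRHS]mulrDl mul1r lerD //; last exact: le_trans MX.
rewrite normrM ger0_norm ?divr_ge0 // ler_wpM2l ?divr_ge0 //.
rewrite ler_norml; apply/andP; split; nra.
Qed.

(** * Sorting pairs by their gcd *)

Lemma box_count_widen B0 B phi : (forall m n, phi m n -> (m < B0)%N /\ (n < B0)%N) ->
  (B0 <= B)%N -> box_count B phi = box_count B0 phi.
Proof.
move=> phiB BB; rewrite /box_count (big_cat_nat _ (n := B0)) //=.
rewrite [X in _ + X]big1_seq ?addr0; last first.
  move=> m; rewrite mem_index_iota => /andP[_ /andP[mM _]].
  rewrite big1 // => n _; case: (boolP (phi m n)) => // /phiB[]; lia.
apply: eq_bigr => m _.
rewrite (big_cat_nat _ (n := B0)) //= [X in _ + X]big1_seq ?addr0 //.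
move=> n; rewrite mem_index_iota => /andP[_ /andP[mM _]].
by case: (boolP (phi m n)) => // /phiB[]; lia.
Qed.

Lemma sum_multiples k B (F : nat -> R) : (0 < k)%N ->
  (forall m, F m != 0 -> (k %| m)%N && (m < B)%N) ->
  \sum_(0 <= m < B) F m = \sum_(0 <= m < B) F (k * m)%N.
Proof.
move=> k0 HF.
(* The longer range splits into [B] blocks of length [k], in each of which only the first index is a
   multiple of [k]. *)
transitivity (\sum_(0 <= m < B * k) F m).
  rewrite [RHS](big_cat_nat _ (n := B)) ?leq_pmulr //=.
  rewrite [X in _ + X]big1_seq ?addr0 //.
  move=> m; rewrite mem_index_iota => /andP[_ /andP[mM _]].
  by apply/eqP/negPn/negP => /HF /andP[_]; rewrite ltnNge mM.
rewrite big_nat_mul; apply: eq_bigr => i _.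
rewrite big_ltn ?ltn_pmul2r //= big1_seq ?addr0 1?mulnC //.
move=> m; rewrite mem_index_iota => /andP[_ /andP[m1 m2]].
apply/eqP/negPn/negP => /HF /andP[/dvdnP[j jm] _]; move: m1 m2.
rewrite jm mulnC !ltn_pmul2r //; lia.
Qed.

Lemma box_count_multiples k B phi psi : (0 < k)%N ->
  (forall m n, phi m n -> [/\ (k %| m)%N, (k %| n)%N, (m < B)%N & (n < B)%N]) ->
  (forall m n, phi (k * m)%N (k * n)%N = psi m n) ->
  box_count B phi = box_count B psi.
Proof.
move=> k0 Hphi Hpsi; rewrite /box_count (sum_multiples k0) //; last first.
  move=> m; apply: contraR => Hm; rewrite big1 // => n _.
  by apply/eqP; move: Hm; apply: contraR; case: (boolP (phi m n)) => [/Hphi[-> _ -> _]//|]; rewrite eqxx.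
apply: eq_bigr => m _.
rewrite (sum_multiples k0) //; last first.
  by move=> n; case: (boolP (phi _ n)) => [/Hphi[_ -> _ ->]//|]; rewrite eqxx.
by apply: eq_bigr => n _; rewrite Hpsi.
Qed.

Lemma box_count_gcd B phi :
  (forall m n, phi m n -> [/\ (0 < m)%N, (m < B)%N & (n < B)%N]) ->
  box_count B phi =
  \sum_(1 <= k < B) box_count B (fun m n => phi (k * m)%N (k * n)%N && coprime m n).
Proof.
move=> Hphi.
transitivity (\sum_(1 <= k < B) box_count B (fun m n => phi m n && (gcdn m n == k))).
  rewrite exchange_big; apply: eq_bigr => m _ /=.
  rewrite exchange_big; apply: eq_bigr => n _ /=.
  case: (boolP (phi m n)) => /= [/Hphi[m0 mB nB]|_]; last by rewrite big1.
  have g0 : (0 < gcdn m n)%N by rewrite gcdn_gt0 m0.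
  have gB : (gcdn m n < B)%N by rewrite (leq_ltn_trans _ mB) // dvdn_leq ?dvdn_gcdl.
  rewrite (bigD1_seq (gcdn m n)) ?iota_uniq ?mem_index_iota ?g0 //= eqxx.
  by rewrite big1 ?addr0 // => i; rewrite eq_sym => /negbTE ->.
rewrite big_nat [RHS]big_nat; apply: eq_bigr => k /andP[k0 _].
apply: (@box_count_multiples k) => // [m n|m n].
  move=> /andP[/Hphi[m0 mB nB] /eqP <-]; split => //; [exact: dvdn_gcdl|exact: dvdn_gcdr].
congr (_ && _); rewrite -muln_gcdr /coprime -{2}[k]muln1 eqn_pmul2l //.
Qed.

End BoxCount.

(** * Sums over dilations *)

Section DilationSums.
Variable R : realType.
Implicit Types (f h p n : R -> R) (T C M A e : R) (B K k : nat).

Definition vanishes f := forall e, 0 < e -> exists T0, forall T, T0 <= T -> `|f T| <= e.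

(** Telescoping of [1 / k^2 <= 1 / (k - 1) - 1 / k]. *)
Lemma sum_inv_sqr_tail K d : (0 < K)%N ->
  \sum_(K.+1 <= k < K.+1 + d) (k%:R ^+ 2)^-1 <= K%:R^-1 - (K + d)%:R^-1 :> R.
Proof.
move=> K0; elim: d => [|d IH]; first by rewrite !addn0 big_geq // subrr.
rewrite addnS big_nat_recr ?leq_addr //= (le_trans (lerD IH (lexx _))) //.
rewrite addSn addnS -natr1; set x : R := (K + d)%:R.
have x0 : 0 < x by rewrite ltr0n addn_gt0 K0.
rewrite -addrA lerD2l -subr_ge0.
have -> : - (x + 1)^-1 - (- x^-1 + ((x + 1) ^+ 2)^-1) = (x * (x + 1) ^+ 2)^-1.
  by clearbody x; field; rewrite !gt_eqF ?addr_gt0.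
by rewrite invr_ge0 mulr_ge0 ?sqr_ge0 // ltW.
Qed.

Lemma sum_inv_sqr_tail_le K B : (0 < K)%N ->
  \sum_(K.+1 <= k < B) (k%:R ^+ 2)^-1 <= K%:R^-1 :> R.
Proof.
move=> K0; have [BK|KB] := leqP B K.+1; first by rewrite big_geq ?invr_ge0.
rewrite -(subnKC (ltnW KB)); apply: le_trans (sum_inv_sqr_tail _ K0) _.
by rewrite gerBl invr_ge0.
Qed.

(** [3 / 4] is the term [1 / 4] plus the tail bound [1 / 2]. Splitting off that term matters: the
    tail bound from [K = 1] is only 1, which would give no contraction. *)
Lemma sum_inv_sqr_le B : \sum_(2 <= k < B) (k%:R ^+ 2)^-1 <= 3 / 4 :> R.
Proof.
have [B2|B2] := leqP B 2; first by rewrite big_geq //; lra.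
rewrite big_ltn //; have := @sum_inv_sqr_tail_le 2 B isT; lra.
Qed.

(** For [k <= K] the argument [T / k^2] is still past the threshold, so [M] applies and the weights
    add up to at most [3 / 4]; for [k > K] the global bound [C] against the tail [1 / K] costs at
    most [e]. *)
Lemma dilation_sum_le f C M T0 e :
  (forall T, 0 < T -> 0 <= f T <= C) -> (forall T, T0 <= T -> f T <= M) -> 0 < e ->
  exists T1, forall T B, T1 <= T ->
    \sum_(2 <= k < B) f (T / k%:R ^+ 2) / k%:R ^+ 2 <= 3 / 4 * M + e.
Proof.
move=> fC fM e0.
have C0 : 0 <= C.
  by have /andP[a b] := fC 1 ltr01; exact: le_trans b.
pose T0' := Num.max T0 1.
have M0 : 0 <= M.
  have T0'0 : 0 < T0' by rewrite lt_max ltr01 orbT.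
  have /andP[a _] := fC _ T0'0; apply: (le_trans a); apply: fM.
  by rewrite le_max lexx.
pose K := (Num.truncn (C / e)).+1.
have K0 : 0 < K%:R :> R by rewrite ltr0n.
have CK : C / K%:R <= e.
  rewrite ler_pdivrMr // mulrC -ler_pdivrMr //.
  by rewrite ltW // truncnS_gt.
exists (K%:R ^+ 2 * T0') => T B TT.
have T'0 : 0 < T0' by rewrite lt_max ltr01 orbT.
have T_gt0 : 0 < T by rewrite (lt_le_trans _ TT) // mulr_gt0 // exprn_gt0.
apply: (@le_trans _ _ (\sum_(2 <= k < B) (M * (k%:R ^+ 2)^-1 +
    C * ((K < k)%N%:R * (k%:R ^+ 2)^-1)))).
  rewrite big_nat [leRHS]big_nat; apply: ler_sum => k /andP[k2 _].
  have k0 : 0 < k%:R :> R by rewrite ltr0n (leq_trans _ k2).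
  have k20 : 0 < k%:R ^+ 2 :> R by rewrite exprn_gt0.
  have Tk : 0 < T / k%:R ^+ 2 by rewrite divr_gt0.
  rewrite mulrA -mulrDl ler_wpM2r ?invr_ge0 ?(ltW k20) //.
  have [kK|Kk] := leqP k K; rewrite /= ?mulr0 ?addr0 ?mulr1.
    apply: fM; rewrite ler_pdivlMr //.
    apply: (@le_trans _ _ (K%:R ^+ 2 * T0')); last exact: TT.
    apply: (@le_trans _ _ (T0' * k%:R ^+ 2)).
      by rewrite ler_pM2r // le_max lexx.
    by rewrite mulrC ler_pM2r // ler_sqr ?nnegrE // ler_nat.
  by have /andP[_ fTC] := fC _ Tk; rewrite (le_trans fTC) // lerDr.
rewrite big_split /= -!mulr_sumr; apply: lerD.
  by rewrite mulrC ler_wpM2r // sum_inv_sqr_le.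
apply: le_trans CK; rewrite ler_wpM2l //.
apply: le_trans (@sum_inv_sqr_tail_le K B isT).
have [BK|KB] := leqP B K.+1.
  rewrite [leRHS]big_geq // big_nat big1 // => k /andP[_ kB].
  by rewrite (_ : (K < k)%N = false) ?mul0r //; lia.
have K1 : (2 <= K.+1)%N by [].
rewrite (big_cat_nat _ (n := K.+1)) //=; last exact: ltnW.
rewrite big_nat big1 ?add0r; last first.
  by move=> k /andP[_ kB]; rewrite (_ : (K < k)%N = false) ?mul0r //; lia.
rewrite big_nat [leRHS]big_nat; apply: ler_sum => k /andP[kK _].
by rewrite kK mul1r.
Qed.

(* [f T = h T - \sum_(k >= 2) f (T / k^2) / k^2] and [\sum_(k >= 2) 1 / k^2 <= 3/4],
   so an eventual bound [M > 0] on [f] improves to [7/8 M]. *)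
Lemma dilation_sum_vanishes f h C :
  (forall T, 0 < T -> `|f T| <= C) ->
  (forall T, 0 < T -> exists2 B, (1 < B)%N &
     h T = \sum_(1 <= k < B) f (T / k%:R ^+ 2) / k%:R ^+ 2) ->
  vanishes h -> vanishes f.
Proof.
move=> fC hf h0.
have C0 : 0 <= C by exact: le_trans (fC 1 ltr01).
have C1 : 0 < C + 1 by lra.
(* Starting from [C + 1] keeps every bound [M] positive even if [C = 0], so that [M / 16] is an
   admissible error; the factor is [3/4 + 1/16 + 1/16 = 7/8]. *)
suff step N : exists T0, forall T, T0 <= T -> `|f T| <= (C + 1) * (7 / 8) ^+ N.
  move=> e e0.
  have z1 : `|7 / 8 : R| < 1 by rewrite ger0_norm; lra.
  have /cvgrPdist_le/(_ e e0)[N _ /(_ N (leqnn N)) /=] :=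
    @cvg_geometric R (C + 1) _ z1.
  rewrite sub0r normrN ger0_norm => [eN|]; last first.
    by rewrite mulr_ge0 ?exprn_ge0 //; lra.
  by have [T0 HT] := step N; exists T0 => T /HT /le_trans; exact.
elim: N => [|N [T0 IH]].
  exists 1 => T T1; rewrite expr0 mulr1 (le_trans (fC _ _)) ?lerDl //.
  exact: lt_le_trans T1.
set M := (C + 1) * (7 / 8) ^+ N in IH *.
have M0 : 0 < M by rewrite mulr_gt0 // exprn_gt0 //; lra.
have e0 : 0 < M / 16 by lra.
have [T1 HT1] := h0 _ e0.
have [|T2 HT2] := @dilation_sum_le (fun T => `|f T|) C M T0 (M / 16) _ IH e0.
  by move=> T T_gt0; rewrite normr_ge0 fC.
exists (Num.max 1 (Num.max T1 T2)) => T; rewrite !ge_max => /and3P[t1 t2 t3].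
have T_gt0 : 0 < T by exact: lt_le_trans t1.
have [B B1 hE] := hf T T_gt0.
have fE : f T = h T - \sum_(2 <= k < B) f (T / k%:R ^+ 2) / k%:R ^+ 2.
  by rewrite hE big_ltn // expr1n !divr1 addrK.
rewrite fE exprS mulrCA -/M (le_trans (ler_normB _ _)) //.
have := HT1 T t2; have := HT2 T B t3.
have : `|\sum_(2 <= k < B) f (T / k%:R ^+ 2) / k%:R ^+ 2| <=
       \sum_(2 <= k < B) `|f (T / k%:R ^+ 2)| / k%:R ^+ 2.
  rewrite (le_trans (ler_norm_sum _ _ _)) // ler_sum // => k _.
  by rewrite normrM normfV normrX normr_nat.
lra.
Qed.

(** Eventually [n] lies between [15/16 A] and [17/16 A]. As [p <= n], the terms with [k >= 2] take
    away at most [3/4 * 17/16 A + A/16], which leaves [5/64 A] for [p T]. *)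
Lemma dilation_sum_lower p n C A : 0 < A ->
  (forall T, 0 < T -> [/\ 0 <= p T, p T <= n T & n T <= C]) ->
  (forall T, 0 < T -> exists2 B, (1 < B)%N &
     n T = \sum_(1 <= k < B) p (T / k%:R ^+ 2) / k%:R ^+ 2) ->
  vanishes (fun T => n T - A) ->
  exists T0, forall T, T0 <= T -> A / 16 <= p T.
Proof.
move=> A0 pn nE nA.
have e0 : 0 < A / 16 by lra.
have [T1 HT1] := nA _ e0.
have [||T2 HT2] := @dilation_sum_le n C (17 / 16 * A) T1 (A / 16) _ _ e0.
- by move=> T /pn[p0 pn1 nC]; rewrite nC (le_trans p0).
- by move=> T /HT1; rewrite ler_norml; lra.
exists (Num.max 1 (Num.max T1 T2)) => T; rewrite !ge_max => /and3P[t1 t2 t3].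
have T_gt0 : 0 < T by exact: lt_le_trans t1.
have [B B1 nTE] := nE T T_gt0.
have : \sum_(2 <= k < B) p (T / k%:R ^+ 2) / k%:R ^+ 2 <=
       \sum_(2 <= k < B) n (T / k%:R ^+ 2) / k%:R ^+ 2.
  rewrite big_nat [leRHS]big_nat; apply: ler_sum => k /andP[k2 _].
  have k0 : 0 < k%:R ^+ 2 :> R by rewrite exprn_gt0 // ltr0n (leq_trans _ k2).
  rewrite ler_pM2r ?invr_gt0 //.
  by have [] := pn _ (divr_gt0 T_gt0 k0).
have := HT1 T t2; have := HT2 T B t3.
move: nTE; rewrite big_ltn // expr1n !divr1 ler_norml => ->.
lra.
Qed.

End DilationSums.

(** * Lattice points in sectors *)

Lemma vanishes_lincomb (R : realType) (f g : R -> R) (c d : R) :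
  vanishes f -> vanishes g -> vanishes (fun T => c * f T + d * g T).
Proof.
move=> f0 g0 e e0.
have ec (x : R) : 0 < e / 2 / (`|x| + 1) by rewrite !divr_gt0 // ltr_wpDl.
have bnd (x y : R) : `|y| <= e / 2 / (`|x| + 1) -> `|x * y| <= e / 2.
  rewrite ler_pdivlMr ?ltr_wpDl // normrM => xy.
  by apply: le_trans xy; rewrite mulrC ler_wpM2l // lerDl.
have [T1 HT1] := f0 _ (ec c); have [T2 HT2] := g0 _ (ec d).
exists (Num.max T1 T2) => T; rewrite ge_max => /andP[t1 t2].
rewrite (le_trans (ler_normD _ _)) // [leRHS]splitr lerD // bnd //; [exact: HT1|exact: HT2].
Qed.

Section SectorCount.
Variables (R : realType) (w H : R -> R) (lo hi W K : R).
Hypothesis lo_ge0 : 0 <= lo.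
Hypothesis lo_le_hi : lo <= hi.
Hypothesis w_bounds : forall s, lo <= s <= hi -> 0 <= w s <= W.
Hypothesis K_ge0 : 0 <= K.
Hypothesis w_lipschitz : forall s t, lo <= s <= hi -> lo <= t <= hi ->
  `|w s - w t| <= K * `|s - t|.
Hypothesis H_mean : forall a b, lo <= a -> a <= b -> b <= hi ->
  exists2 s, a <= s <= b & H b - H a = w s * (b - a).
Implicit Types (T a b e s : R) (B m n : nat).

(** In the application [w] is [1 / g], so the last condition says that the discriminant is at most
    [T] in absolute value. Half-open slope intervals make adjacent sectors disjoint. *)
Definition half_open_sector a b T m n :=
  [&& (0 < m)%N, a * m%:R <= n%:R < b * m%:R & m%:R ^+ 2 <= T * w (n%:R / m%:R)].

Definition sector a b T m n :=
  [&& (0 < m)%N, a * m%:R <= n%:R <= b * m%:R & m%:R ^+ 2 <= T * w (n%:R / m%:R)].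

(** Bounds not only [w] but also the values [w s + K * (b - a)] that give the heights of
    circumscribed triangles, so one box holds them all. *)
Let W' := W + K * (hi - lo).

(** The factor [1 + hi] covers both coordinates, [m] up to the square root and [n] up to [hi] times
    it. The double successor makes [1 < box_size T] immediate, as the dilation lemmas require. *)
Definition box_size T := (Num.truncn ((1 + hi) * Num.sqrt (T * W'))).+2.

Definition sector_count a b T := box_count R (box_size T) (sector a b T).

Definition primitive_count a b T :=
  box_count R (box_size T) (fun m n => sector a b T m n && coprime m n).

Let hi_ge0 : 0 <= hi. Proof. exact: le_trans lo_le_hi. Qed.

Let W_ge0 : 0 <= W.
Proof. by have /andP[? ?] := w_bounds (introT andP (conj (lexx _) lo_le_hi)); lra. Qed.

Let W'_geW : W <= W'.
Proof. by rewrite lerDl mulr_ge0 // subr_ge0. Qed.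

Let W'_ge0 : 0 <= W'. Proof. exact: le_trans W'_geW. Qed.

Lemma slope_itv a b m n : (0 < m)%N -> a * m%:R <= n%:R <= b * m%:R ->
  a <= n%:R / m%:R <= b.
Proof. by move=> m0; rewrite ler_pdivlMr ?ltr0n // ler_pdivrMr ?ltr0n. Qed.

Lemma le_box_size T x : x <= Num.sqrt (T * W') ->
  x < (box_size T)%:R /\ hi * x < (box_size T)%:R.
Proof.
move=> xT; set X := Num.sqrt _ in xT *; have X0 : 0 <= X by exact: sqrtr_ge0.
have : (1 + hi) * X < (box_size T)%:R.
  rewrite (lt_trans (truncnS_gt _)) // ltr_nat.
  exact: ltnSn.
have : hi * x <= hi * X by rewrite ler_wpM2l.
have : 0 <= hi * X by rewrite mulr_ge0.
lra.
Qed.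

Lemma sector_height a b T m n : lo <= a -> b <= hi -> 0 <= T -> sector a b T m n ->
  m%:R <= Num.sqrt (T * W').
Proof.
move=> loa bhi T0 /and3P[m0 /(slope_itv m0)/andP[as_ sb] mT].
rewrite -[leLHS]ger0_norm // -sqrtr_sqr ler_wsqrtr //.
rewrite (le_trans mT) // ler_wpM2l //.
have /w_bounds/andP[_ /le_trans] : lo <= n%:R / m%:R <= hi.
  by rewrite (le_trans loa) // (le_trans sb).
exact.
Qed.

Lemma sector_box a b T m n : lo <= a -> b <= hi -> 0 <= T -> sector a b T m n ->
  (m < box_size T)%N /\ (n < box_size T)%N.
Proof.
move=> loa bhi T0 mn; have := sector_height loa bhi T0 mn.
move=> /le_box_size[mB nB]; rewrite -(ltr_nat R) mB; split => //.
case/and3P: mn => m0 /andP[_ nb] _.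
rewrite -(ltr_nat R) (le_lt_trans _ nB) // (le_trans nb) //.
by rewrite ler_wpM2r.
Qed.

Let C := ((hi - lo) / 2 + 1) * Num.sqrt W'.

(** On slopes in [[a, b]] the weight stays within [K * D] of its value at the mean value point [s],
    so the sector lies between the triangles of squared heights [T * (w s - K * D)] and
    [T * (w s + K * D)]. Their areas are [T * K * D^2 / 2] away from [T * w s * D / 2], which is the
    main term. *)
Lemma half_open_sector_count a b T : lo <= a -> a <= b -> b <= hi -> 0 <= T ->
  `|box_count R (box_size T) (half_open_sector a b T) - T * (H b - H a) / 2|
  <= T * K * (b - a) ^+ 2 / 2 + C * Num.sqrt T.
Proof.
move=> loa ab bhi T0; set B := box_size T.
have [s sab ->] := H_mean loa ab bhi.
have a0 : 0 <= a by exact: le_trans loa.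
set D := b - a; have D0 : 0 <= D by rewrite subr_ge0.
pose X (x : R) := Num.sqrt (T * x).
have DL : D <= hi - lo by rewrite /D; lra.
have tri x : x <= W' ->
    `|box_count R B (triangle a b (X x)) - D * X x ^+ 2 / 2| <= C * Num.sqrt T.
  move=> xW; have XW : X x <= Num.sqrt (T * W') by rewrite ler_wsqrtr // ler_wpM2l.
  have [XB XB'] := le_box_size XW.
  have bX : b * X x <= B%:R.
    by rewrite (le_trans _ (ltW XB')) // ler_wpM2r // sqrtr_ge0.
  apply: le_trans (triangle_count a0 ab (sqrtr_ge0 _) XB bX) _.
  rewrite -/D /C -mulrA; apply: ler_pM; rewrite ?sqrtr_ge0 //; first lra.
    lra.
  by rewrite (le_trans XW) // mulrC sqrtrM.
have near t : a <= t <= b -> `|w s - w t| <= K * D.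
  move=> /andP[at_ tb]; have /andP[as_ sb] := sab.
  apply: le_trans (w_lipschitz _ _) _; first lra.
    lra.
  by rewrite ler_wpM2l // ler_norml /D; lra.
have KD0 : 0 <= K * D by exact: mulr_ge0.
have /andP[ws0 wsW] : 0 <= w s <= W by apply: w_bounds; lra.
have KDL : K * D <= K * (hi - lo) by rewrite ler_wpM2l.
have up : box_count R B (half_open_sector a b T)
          <= box_count R B (triangle a b (X (w s + K * D))).
  apply: le_box_count => m n /and3P[m0 mn mT]; rewrite /triangle m0 mn andbT /=.
  rewrite -[leLHS]ger0_norm // -sqrtr_sqr ler_wsqrtr // (le_trans mT) // ler_wpM2l //.
  have /near : a <= n%:R / m%:R <= b.
    by apply: slope_itv => //; case/andP: mn => -> /ltW.
  by rewrite ler_norml; lra.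
have down : box_count R B (triangle a b (X (w s - K * D)))
          <= box_count R B (half_open_sector a b T).
  apply: le_box_count => m n /and3P[m0 mX mn]; rewrite /half_open_sector m0 mn /=.
  have /near ws : a <= n%:R / m%:R <= b.
    by apply: slope_itv => //; case/andP: mn => -> /ltW.
  have TX : 0 < T * (w s - K * D).
    by rewrite -sqrtr_gt0 (lt_le_trans _ mX) // ltr0n.
  apply: (@le_trans _ _ (T * (w s - K * D))).
    rewrite -[leRHS]sqr_sqrtr ?(ltW TX) // ler_sqr ?nnegrE ?sqrtr_ge0 //.
  by rewrite ler_wpM2l //; move: ws; rewrite ler_norml; lra.
have Xp : X (w s + K * D) ^+ 2 = T * (w s + K * D).
  by rewrite sqr_sqrtr // mulr_ge0 //; lra.
(* Only an inequality, because [w s - K * D] may be negative and the square root is then 0. *)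
have Xm : T * (w s - K * D) <= X (w s - K * D) ^+ 2.
  have [Tm|Tm] := leP 0 (T * (w s - K * D)); first by rewrite sqr_sqrtr.
  by rewrite (le_trans (ltW Tm)) // sqr_ge0.
have /tri t1 : w s - K * D <= W' by rewrite /W'; lra.
have /tri t2 : w s + K * D <= W' by rewrite /W'; lra.
rewrite Xp in t2.
have DXm : D * (T * (w s - K * D)) <= D * X (w s - K * D) ^+ 2 by rewrite ler_wpM2l.
move: t1 t2 up down DXm; rewrite !ler_norml.
move: (box_count _ _ (half_open_sector _ _ _)) (box_count _ _ _) (box_count _ _ _).
move=> c1 c2 c3.
have -> : T * K * D ^+ 2 / 2 = T * (K * D) * D / 2 by field.
move: (K * D) (X _ ^+ 2) (C * _) => KD XX CT.
move=> t1 t2 up down DXm.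
have e1 : D * (T * (w s + KD)) = T * (w s * D) + T * KD * D by ring.
have e2 : D * (T * (w s - KD)) = T * (w s * D) - T * KD * D by ring.
rewrite e1 in t2; rewrite e2 in DXm.
move: (T * (w s * D)) (T * KD * D) t1 t2 DXm => u1 u2 t1 t2 DXm.
lra.
Qed.

Lemma half_open_sector_cat a b c T m n : a <= b -> b <= c ->
  (half_open_sector a c T m n && (n%:R < b * m%:R) = half_open_sector a b T m n) *
  (half_open_sector a c T m n && ~~ (n%:R < b * m%:R) = half_open_sector b c T m n).
Proof.
move=> ab bc; rewrite /half_open_sector -leNgt.
have ab' : a * m%:R <= b * m%:R by rewrite ler_wpM2r.
have bc' : b * m%:R <= c * m%:R by rewrite ler_wpM2r.
split; case: (0 < m)%N => //=; case: (m%:R ^+ 2 <= _); rewrite ?andbT ?andbF //.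
  by apply/idP/idP; lra.
by apply/idP/idP; lra.
Qed.

(** With [N + 1] equal slices the error quadratic in the width shrinks by the factor [N + 1], while
    the boundary error of order [sqrt T] grows by it. *)
Lemma half_open_sector_partition a b T N : lo <= a -> a <= b -> b <= hi -> 0 <= T ->
  `|box_count R (box_size T) (half_open_sector a b T) - T * (H b - H a) / 2|
  <= T * K * (b - a) ^+ 2 / 2 / N.+1%:R + N.+1%:R * C * Num.sqrt T.
Proof.
move=> loa ab bhi T0; set d := (b - a) / N.+1%:R.
have d0 : 0 <= d by rewrite divr_ge0 // subr_ge0.
have Nd : N.+1%:R * d = b - a by rewrite /d mulrC divfK.
suff step j : (j <= N.+1)%N ->
  `|box_count R (box_size T) (half_open_sector a (a + j%:R * d) T)
    - T * (H (a + j%:R * d) - H a) / 2|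
  <= j%:R * (T * K * d ^+ 2 / 2 + C * Num.sqrt T).
  have := step N.+1 (leqnn _); rewrite Nd (addrC a) subrK => /le_trans; apply.
  rewrite mulrDr mulrA lerD ?mulrA //.
  by rewrite le_eqVlt; apply/orP; left; apply/eqP; rewrite /d; field.
elim: j => [_|j IH jN].
  rewrite !mul0r addr0 subrr mulr0 mul0r subr0 /box_count big1 ?normr0 // => m _.
  rewrite big1 // => n _; rewrite /half_open_sector.
  by case: (boolP (_ && _)) => // /and3P[_ /andP[h1 h2]]; lra.
have {}IH := IH (ltnW jN).
have aj : a <= a + j%:R * d by rewrite lerDl mulr_ge0.
have ajS : a + j.+1%:R * d = a + j%:R * d + d by rewrite -natr1; ring.
have jb : a + j.+1%:R * d <= b.
  rewrite -lerBrDl -Nd ler_wpM2r // ler_nat //.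
rewrite ajS in jb *; set c := a + j%:R * d in aj jb IH *.
have cc : c <= c + d by rewrite lerDl.
rewrite (box_count_split _ _ _ (fun m n => n%:R < c * m%:R)).
rewrite (eq_box_count _ _ (fun m n => (half_open_sector_cat T m n aj cc).1)).
rewrite (eq_box_count _ _ (fun m n => (half_open_sector_cat T m n aj cc).2)).
have := half_open_sector_count (le_trans loa aj) cc (le_trans jb bhi) T0.
rewrite (addrC c d) addrK (addrC d c) => Hc.
have -> : H (c + d) - H a = (H (c + d) - H c) + (H c - H a) by ring.
set E := T * K * _ / 2 + _ in IH Hc *.
rewrite -[j.+1%:R]natr1 [leRHS]mulrDl mul1r mulrDr mulrDl.
rewrite [leRHS]addrC [X in `|X - _|]addrC opprD addrACA.
by rewrite (le_trans (ler_normD _ _)) // lerD.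
Qed.

(** Closing the sector adds the points with [n = b * m]: at most one in each row, and the rows stop
    at [sqrt (T * W')]. *)
Lemma sector_count_estimate a b T N : lo <= a -> a <= b -> b <= hi -> 0 <= T ->
  `|sector_count a b T - T * (H b - H a) / 2|
  <= T * K * (b - a) ^+ 2 / 2 / N.+1%:R + (N.+1%:R * C + Num.sqrt W') * Num.sqrt T.
Proof.
move=> loa ab bhi T0.
have := half_open_sector_partition N loa ab bhi T0.
set B := box_size T; set Y := Num.sqrt W' * Num.sqrt T.
have line : box_count R B (fun m n => sector a b T m n && ~~ (n%:R < b * m%:R)) <= Y.
  have XB := (le_box_size (lexx (Num.sqrt (T * W')))).1; rewrite -/B in XB.
  set X := Num.sqrt _ in XB.
  have X0 : 0 <= X by exact: sqrtr_ge0.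
  have -> : Y = X by rewrite /Y -sqrtrM // mulrC.
  apply: (@le_trans _ _ (Num.truncn X)%:R); last by rewrite truncn_le.
  rewrite -sum_pos.
  rewrite -(sum_le_truncn (fun m => (0 < m)%N%:R) X0 XB) //.
  apply: ler_sum => m _.
  have [mX|mX] := boolP ((0 < m)%N && (m%:R <= X)); last first.
    rewrite big1 ?mulr_ge0 // => n _.
    case: (boolP (_ && _)) => // /andP[mn _]; case/negP: mX.
    have := mn; case/and3P => -> _ _ /=.
    exact: sector_height mn.
  case/andP: mX => -> ->; rewrite mulr1.
  pose j := Num.truncn (b * m%:R).
  apply: (@le_trans _ _ (\sum_(0 <= n < B) (n == j)%:R)).
    apply: ler_sum => n _; rewrite ler_nat.
    case: (boolP (_ && _)) => // /andP[/and3P[_ /andP[_ nb] _] bn].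
    have -> : n = j; last by rewrite eqxx.
    rewrite /j; have -> : b * m%:R = n%:R.
      by apply/eqP; rewrite eq_le nb andbT leNgt.
    by rewrite natrK.
  have [jB|Bj] := ltnP j B.
    rewrite (bigD1_seq j) ?iota_uniq ?mem_index_iota //= eqxx big1 ?addr0 // => i.
    by move=> /negbTE ->.
  rewrite big_nat big1 ?ler01 // => i /andP[_ iB].
  by rewrite (_ : (i == j) = false) //; apply/eqP; lia.
have -> : sector_count a b T = box_count R B (half_open_sector a b T) +
    box_count R B (fun m n => sector a b T m n && ~~ (n%:R < b * m%:R)).
  rewrite /sector_count (box_count_split _ _ _ (fun m n => n%:R < b * m%:R)).
  congr (_ + _); apply: eq_box_count => m n; rewrite /sector /half_open_sector.
  case: (0 < m)%N => //=; case: (m%:R ^+ 2 <= _); rewrite ?andbT ?andbF //.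
  by apply/idP/idP; lra.
have := box_count_ge0 R B (fun m n => sector a b T m n && ~~ (n%:R < b * m%:R)).
move: line; move: (box_count _ _ _) => c1; move: (box_count _ _ _) => c2.
rewrite mulrDl -/Y !ler_norml; clearbody Y.
move: (_ / N.+1%:R) (_ * C * _) (T * _ / 2) => u v z; lra.
Qed.

Lemma sector_count_asymptotic a b : lo <= a -> a <= b -> b <= hi ->
  vanishes (fun T => sector_count a b T / T - (H b - H a) / 2).
Proof.
move=> loa ab bhi e e0.
(* [N] is fixed by [e] alone, so that the slicing error is at most [e / 2 * T]; then [T] is taken
   large enough for [Z * sqrt T] to be at most [e / 2 * T]. *)
pose N := Num.truncn (K * (b - a) ^+ 2 / e).
have Ne : K * (b - a) ^+ 2 / N.+1%:R <= e.
  by rewrite ler_pdivrMr ?ltr0n // [leRHS]mulrC -ler_pdivrMr // ltW // truncnS_gt.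
pose Z := N.+1%:R * C + Num.sqrt W'.
have C0 : 0 <= C by rewrite mulr_ge0 ?sqrtr_ge0 //; lra.
have Z0 : 0 <= Z by rewrite addr_ge0 ?sqrtr_ge0 // mulr_ge0.
exists (Num.max 1 ((2 * Z / e) ^+ 2)) => T; rewrite ge_max => /andP[T1 TZ].
have T0 : 0 < T by lra.
have sT : 0 < Num.sqrt T by rewrite sqrtr_gt0.
have -> : sector_count a b T / T - (H b - H a) / 2 =
  (sector_count a b T - T * (H b - H a) / 2) / T by field; rewrite gt_eqF.
rewrite normrM normfV [X in _ / X](gtr0_norm T0) ler_pdivrMr //.
apply: le_trans (sector_count_estimate N loa ab bhi (ltW T0)) _.
rewrite -/Z.
have ZT : 2 * Z <= e * Num.sqrt T.
  rewrite -ler_pdivrMl // mulrC -[leLHS]ger0_norm ?divr_ge0 ?mulr_ge0 ?(ltW e0) //.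
  by rewrite -sqrtr_sqr ler_wsqrtr.
have : Z * Num.sqrt T <= e / 2 * T.
  rewrite -{2}(sqr_sqrtr (ltW T0)) expr2 mulrA ler_pM2r //; lra.
have : T * K * (b - a) ^+ 2 / 2 / N.+1%:R <= e / 2 * T.
  have -> : T * K * (b - a) ^+ 2 / 2 / N.+1%:R =
     T / 2 * (K * (b - a) ^+ 2 / N.+1%:R) by field; rewrite addrC natr1 pnatr_eq0.
  have -> : e / 2 * T = T / 2 * e by field.
  by rewrite ler_pM2l // divr_gt0.
by move=> h1 h2; apply: le_trans (lerD h1 h2) _; lra.
Qed.

Lemma primitive_count_le a b T : 0 <= primitive_count a b T <= sector_count a b T.
Proof.
by rewrite box_count_ge0 le_box_count // => m n /andP[].
Qed.

(** For [T * W' < 1] the sector is empty, as [m >= 1]; otherwise [sqrt T <= sqrt W' * T], and the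
    boundary error is absorbed into the linear term. *)
Lemma sector_count_le a b : lo <= a -> a <= b -> b <= hi ->
  exists M, forall T, 0 < T -> sector_count a b T <= M * T.
Proof.
move=> loa ab bhi.
exists (`|H b - H a| / 2 + K * (b - a) ^+ 2 / 2 + (C + Num.sqrt W') * Num.sqrt W').
move=> T T0.
have C0 : 0 <= C by rewrite mulr_ge0 ?sqrtr_ge0 //; lra.
have [TW|TW] := ltP (T * W') 1.
  have KD : 0 <= K * (b - a) ^+ 2 by rewrite mulr_ge0 ?sqr_ge0.
  have CW : 0 <= (C + Num.sqrt W') * Num.sqrt W'.
    by rewrite mulr_ge0 ?addr_ge0 ?sqrtr_ge0.
  rewrite /sector_count /box_count big1.
    by rewrite mulr_ge0 ?(ltW T0) // !addr_ge0 // divr_ge0.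
  move=> m _; rewrite big1 // => n _; case: (boolP (sector _ _ _ _ _)) => // mn.
  have := sector_height loa bhi (ltW T0) mn.
  rewrite leNgt (lt_le_trans (y := 1)) //.
    by rewrite -[ltRHS]sqrtr1 ltr_sqrt.
  by case/and3P: mn; rewrite ler1n.
have sT : 0 <= Num.sqrt T by exact: sqrtr_ge0.
have : Num.sqrt T <= Num.sqrt W' * T.
  rewrite -{2}(sqr_sqrtr (ltW T0)) expr2 mulrA ler_peMl // -sqrtrM // -sqrtr1.
  by rewrite ler_wsqrtr // mulrC.
have := sector_count_estimate 0 loa ab bhi (ltW T0).
rewrite divr1 mul1r ler_norml => /andP[_ h1] h2.
have h3 : (C + Num.sqrt W') * Num.sqrt T <= (C + Num.sqrt W') * (Num.sqrt W' * T).
  by rewrite ler_wpM2l // addr_ge0 // sqrtr_ge0.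
have h4 : T * (H b - H a) <= T * `|H b - H a|.
  by rewrite ler_wpM2l ?(ltW T0) // ler_norm.
rewrite !mulrDl; move: h1 h3 h4; rewrite !mulrDl; lra.
Qed.

(** The slope is invariant under [(m, n) -> (k m, k n)] and the height condition is homogeneous of
    degree 2, so pairs of gcd [k] at [T] are coprime pairs at [T / k^2]. The smaller box belonging
    to [T / k^2] already contains the latter. *)
Lemma sector_count_primitive a b T : lo <= a -> b <= hi -> 0 < T ->
  sector_count a b T =
  \sum_(1 <= k < box_size T) primitive_count a b (T / k%:R ^+ 2).
Proof.
move=> loa bhi T0; rewrite /sector_count box_count_gcd; last first.
  move=> m n mn; have [mB nB] := sector_box loa bhi (ltW T0) mn.
  by split => //; case/and3P: mn.
rewrite big_nat [RHS]big_nat; apply: eq_bigr => k /andP[k1 _].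
have k0 : 0 < k%:R :> R by rewrite ltr0n.
have k20 : 0 < k%:R ^+ 2 :> R by rewrite exprn_gt0.
have Tk0 : 0 < T / k%:R ^+ 2 by exact: divr_gt0.
rewrite /primitive_count -(@box_count_widen _ (box_size (T / k%:R ^+ 2)) (box_size T)).
- apply: eq_box_count => m n; congr (_ && _); rewrite /sector muln_gt0 k1 /=.
  case: (posnP m) => //= m0; rewrite !natrM.
  rewrite !(mulrCA _ k%:R) !(ler_pM2l k0); congr (_ && _).
  rewrite exprMn -mulf_div divff ?gt_eqF // mul1r [X in X <= _]mulrC -ler_pdivlMr //.
  by rewrite mulrAC.
- by move=> m n /andP[/(sector_box loa bhi (ltW Tk0))].
- rewrite /box_size !ltnS; apply: le_truncn.
  rewrite ler_wpM2l ?addr_ge0 // ler_wsqrtr // ler_wpM2r //.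
  by rewrite ler_pdivrMr // ler_peMr ?(ltW T0) // exprn_ege1 // ler1n.
Qed.

Lemma primitive_count_ratio a1 b1 a2 b2 :
  lo <= a1 -> a1 <= b1 -> b1 <= hi -> lo <= a2 -> a2 <= b2 -> b2 <= hi ->
  H a2 < H b2 ->
  vanishes (fun T => primitive_count a1 b1 T / primitive_count a2 b2 T
                     - (H b1 - H a1) / (H b2 - H a2)).
Proof.
move=> lo1 ab1 hi1 lo2 ab2 hi2 H2.
pose A1 := (H b1 - H a1) / 2; pose A2 := (H b2 - H a2) / 2.
have A20 : 0 < A2 by rewrite divr_gt0 // subr_gt0.
pose p1 T := primitive_count a1 b1 T / T; pose p2 T := primitive_count a2 b2 T / T.
pose n1 T := sector_count a1 b1 T / T; pose n2 T := sector_count a2 b2 T / T.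
have [M1 HM1] := sector_count_le lo1 ab1 hi1.
have [M2 HM2] := sector_count_le lo2 ab2 hi2.
have p1n1 T : 0 < T -> [/\ 0 <= p1 T, p1 T <= n1 T & n1 T <= M1].
  move=> T0; have /andP[P0 PN] := primitive_count_le a1 b1 T.
  by rewrite ler_pM2r ?invr_gt0 // ler_pdivrMr // HM1 ?divr_ge0 ?(ltW T0).
have p2n2 T : 0 < T -> [/\ 0 <= p2 T, p2 T <= n2 T & n2 T <= M2].
  move=> T0; have /andP[P0 PN] := primitive_count_le a2 b2 T.
  by rewrite ler_pM2r ?invr_gt0 // ler_pdivrMr // HM2 ?divr_ge0 ?(ltW T0).
have dil (k : nat) (T x : R) : (0 < k)%N -> 0 < T -> x / (T / k%:R ^+ 2) / k%:R ^+ 2 = x / T.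
  move=> k0 T0; field; rewrite gt_eqF // gt_eqF //= ?ltr0n //.
have n1E T : 0 < T -> n1 T = \sum_(1 <= k < box_size T) p1 (T / k%:R ^+ 2) / k%:R ^+ 2.
  move=> T0; rewrite /n1 sector_count_primitive // mulr_suml.
  rewrite big_nat [RHS]big_nat; apply: eq_bigr => k /andP[k0 _].
  by rewrite /p1 dil.
have n2E T : 0 < T -> n2 T = \sum_(1 <= k < box_size T) p2 (T / k%:R ^+ 2) / k%:R ^+ 2.
  move=> T0; rewrite /n2 sector_count_primitive // mulr_suml.
  rewrite big_nat [RHS]big_nat; apply: eq_bigr => k /andP[k0 _].
  by rewrite /p2 dil.
have va1 : vanishes (fun T => n1 T - A1) by exact: sector_count_asymptotic.
have va2 : vanishes (fun T => n2 T - A2) by exact: sector_count_asymptotic.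
have [T1 HT1] : exists T0, forall T, T0 <= T -> A2 / 16 <= p2 T.
  apply: (@dilation_sum_lower _ p2 n2 M2) => // T T0.
  by exists (box_size T) => //; exact: n2E.
pose f T := A2 * p1 T - A1 * p2 T.
have vf : vanishes f.
  apply: (@dilation_sum_vanishes _ f (fun T => A2 * (n1 T - A1) + - A1 * (n2 T - A2))
    (A2 * M1 + `|A1| * M2)).
  - move=> T T0; have [h1 h2 h3] := p1n1 T T0; have [h4 h5 h6] := p2n2 T T0.
    rewrite (le_trans (ler_normB _ _)) // (normrM A2) (normrM A1).
    rewrite (ger0_norm (ltW A20)) (ger0_norm h1) (ger0_norm h4).
    by rewrite lerD // ler_wpM2l ?(ltW A20) //; [exact: le_trans h3|exact: le_trans h6].
  - move=> T T0; exists (box_size T) => //.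
    rewrite /f; under eq_bigr do rewrite mulrBl -(mulrA A2) -(mulrA A1).
    rewrite sumrB -!mulr_sumr -n1E // -n2E //; ring.
  - exact: vanishes_lincomb.
move=> e e0.
(* The error of the ratio is [f T / (A2 * p2 T)], with [p2 T >= A2 / 16]. *)
have e1 : 0 < e * (A2 * (A2 / 16)).
  by apply: mulr_gt0 => //; apply: mulr_gt0 => //; apply: divr_gt0.
have [T2 HT2] := vf _ e1.
exists (Num.max 1 (Num.max T1 T2)) => T; rewrite !ge_max => /and3P[t1 t2 t3].
have T0 : 0 < T by lra.
have p20 : 0 < p2 T by rewrite (lt_le_trans _ (HT1 _ t2)) // divr_gt0.
have P20 : primitive_count a2 b2 T != 0.
  by apply: contraTN p20 => /eqP; rewrite /p2 => ->; rewrite mul0r ltxx.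
have -> : primitive_count a1 b1 T / primitive_count a2 b2 T -
   (H b1 - H a1) / (H b2 - H a2) = f T / (A2 * p2 T).
  rewrite /f /A1 /A2 /p1 /p2; field; rewrite P20 (gt_eqF T0) subr_eq0 (gt_eqF H2) //.
have Ap0 : 0 < A2 * p2 T by exact: mulr_gt0.
rewrite normrM normfV (gtr0_norm Ap0) ler_pdivrMr //.
rewrite (le_trans (HT2 _ t3)) // ler_pM2l // ler_pM2l //; exact: HT1.
Qed.

End SectorCount.

(** * Slope charts of rational geodesics *)

(** Echelon form for a subgroup of [Z^3]: take an element with least positive first coordinate.
    Division with remainder by it leaves an element with first coordinate 0, to which the second
    hypothesis applies. *)
Lemma int_lattice_basis (L : int -> int -> int -> Prop) (b2 c2 : int) :
  (forall k a b c a' b' c', L a b c -> L a' b' c' ->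
     L (a - k * a') (b - k * b') (c - k * c')) ->
  (forall b c, L 0 b c -> exists n, b = n * b2 /\ c = n * c2) ->
  (exists a b c, 0 < a /\ L a b c) ->
  exists a1 b1 c1, [/\ 0 < a1, L a1 b1 c1 & forall a b c, L a b c ->
    exists m n, [/\ a = m * a1, b = m * b1 + n * b2 & c = m * c1 + n * c2]].
Proof.
move=> Lsub L0 [a0 [b0 [c0 [a00 Labc0]]]].
pose P (n : nat) := `[< (0 < n)%N /\ exists b c, L n%:Z b c >].
have exP : exists n, P n.
  exists `|a0|%N; apply/asboolP; split; first by lia.
  by exists b0, c0; rewrite gez0_abs // ltW.
case: (ex_minnP exP) => n /asboolP[n0 [b1 [c1 Ln]]] nmin.
exists n%:Z, b1, c1; split => // a b c Labc.
set m := (a %/ n)%Z; set r := (a %% n)%Z.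
have aE : a = m * n%:Z + r by exact: divz_eq.
have r0 : 0 <= r by rewrite modz_ge0 //; lia.
have rn : r < n%:Z by rewrite ltz_mod //; lia.
have Lr : L r (b - m * b1) (c - m * c1).
  by have := Lsub m _ _ _ _ _ _ Labc Ln; rewrite {1}aE addrAC subrr add0r.
have r_eq0 : r = 0.
  apply/eqP; apply/negPn/negP => rN0.
  suff /nmin : P `|r|%N by lia.
  apply/asboolP; split; first by lia.
  by exists (b - m * b1), (c - m * c1); rewrite gez0_abs.
rewrite r_eq0 in Lr aE; have [k [bE cE]] := L0 _ _ Lr.
exists m, k; split; [by rewrite aE addr0|..].
  by rewrite -bE addrC subrK.
by rewrite -cE addrC subrK.
Qed.

Section Chart.
Variable R : realType.
Implicit Types (G : geodesic R) (q r s t u v x : R) (z : R[i]).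

(** Closed form of [hyp_speed (param G)] on the domain, where its continuity and sign are
    evident. *)
Definition arc_speed G t : R :=
  match G with Vertical _ => t^-1 | Semicircle _ _ _ => (sin t)^-1 end.

Lemma param_dom_itv G u v t : param_dom G u -> param_dom G v -> u <= t <= v ->
  param_dom G t.
Proof.
case: G => [x|q r r0] /=; rewrite !in_itv /=; first by lra.
by move=> /andP[? ?] /andP[? ?] /andP[? ?]; apply/andP; lra.
Qed.

Lemma arc_speedE G t : param_dom G t -> hyp_speed (param G) t = arc_speed G t.
Proof.
case: G => [x|q r r0]; rewrite [param_dom _ _]/= in_itv /=.
  by rewrite andbT; exact: hyp_speed_vertical.
exact: hyp_speed_semicircle.
Qed.

Lemma arc_speed_gt0 G t : param_dom G t -> 0 < arc_speed G t.
Proof.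
case: G => [x|q r r0]; rewrite [param_dom _ _]/= in_itv /= invr_gt0 ?andbT //.
exact: sin_gt0_pi.
Qed.

Lemma arc_speed_continuous G t : param_dom G t -> {for t, continuous (arc_speed G)}.
Proof.
case: G => [x|q r r0] Dt; have := arc_speed_gt0 Dt; rewrite /= invr_gt0 => t0.
  by apply: inv_continuous; rewrite gt_eqF.
apply: (@continuous_comp _ _ _ (@sin R) GRing.inv); first exact: continuous_sin.
by apply: inv_continuous; rewrite gt_eqF.
Qed.

Lemma param_Im_gt0 G t : param_dom G t -> 0 < complex.Im (param G t).
Proof.
by move=> Dt; apply: (@geodesic_halfplane R G); exists t.
Qed.

(** Minus the discriminant of the real form [(a1, b1 + b2 s, c1 + c2 s)]. *)
Definition disc_form (a1 b1 c1 b2 c2 : int) s : R :=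
  4 * a1%:~R * (c1%:~R + c2%:~R * s) - (b1%:~R + b2%:~R * s) ^+ 2.

(* [(a1, b1, c1)] and [(0, b2, c2)] are a basis of the lattice of binary quadratic
   forms whose root lies on [G]; [sigma t] is the slope [n / m] of the forms
   [m (a1, b1, c1) + n (0, b2, c2)] with root [param G t], and their discriminant is
   [- m ^ 2 * disc_form (sigma t)]. *)
Record slope_chart G (a1 b1 c1 b2 c2 : int) (sigma H : R -> R) (k : R) : Prop := {
  chart_a_gt0 : 0 < a1;
  chart_k_gt0 : 0 < k;
  chart_nontrivial : (b2 != 0) || (c2 != 0);
  chart_Re : forall t, param_dom G t ->
    - (2 * a1%:~R * complex.Re (param G t)) = b1%:~R + b2%:~R * sigma t;
  chart_norm : forall t, param_dom G t ->
    a1%:~R * (complex.Re (param G t) ^+ 2 + complex.Im (param G t) ^+ 2)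
    = c1%:~R + c2%:~R * sigma t;
  chart_span : forall t, param_dom G t -> forall a b c : int,
    b%:~R = - (2 * a%:~R * complex.Re (param G t)) ->
    c%:~R = a%:~R * (complex.Re (param G t) ^+ 2 + complex.Im (param G t) ^+ 2) ->
    exists m n, [/\ a = m * a1, b = m * b1 + n * b2 & c = m * c1 + n * c2];
  chart_derive : forall t, param_dom G t ->
    is_derive t 1 sigma (k * arc_speed G t * disc_form a1 b1 c1 b2 c2 (sigma t));
  chart_primitive : forall t, param_dom G t ->
    is_derive (sigma t) 1 H (disc_form a1 b1 c1 b2 c2 (sigma t))^-1 }.

Lemma rational_fraction x : rational x ->
  exists p : rat, x = (numq p)%:~R / (denq p)%:~R.
Proof. by move=> [p _ <-]; exists p. Qed.

Lemma is_derive_ln_affine (c d s : R) : 0 < c + d * s ->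
  is_derive s 1 (fun x => ln (c + d * x)) (d / (c + d * s)).
Proof.
move=> h; have h1 : is_derive s 1 (fun x => c + d * x) d.
  by apply: is_derive_eq; rewrite /GRing.scale /=; ring.
have := @is_derive1_comp R (@ln R) (fun x => c + d * x) s _ _ (is_derive1_ln h) h1.
by rewrite mulrC.
Qed.

Lemma vertical_chart x u : rational x -> param_dom (Vertical x) u ->
  exists a1 b1 c1 b2 c2 sigma H k,
    slope_chart (Vertical x) a1 b1 c1 b2 c2 sigma H k /\ 0 <= sigma u.
Proof.
move=> /rational_fraction[p xE] _.
pose L (a b c : int) := b%:~R = - (2 * a%:~R * x).
have [|||a1 [b1 [c1 [a10 Lv Lspan]]]] := @int_lattice_basis L 0 1.
- move=> k a b c a' b' c'; rewrite /L !rmorphB !rmorphM /= => -> ->; ring.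
- move=> b c; rewrite /L mulr0 mul0r oppr0 => /eqP; rewrite intr_eq0 => /eqP ->.
  by exists c; rewrite mulr0 mulr1.
- exists (denq p), (- (2 * numq p)), 0; split; first exact: denq_gt0.
  rewrite /L xE rmorphN rmorphM /=; field.
  by rewrite intr_eq0 denq_neq0.
set A : R := a1%:~R; have A0 : 0 < A by rewrite ltr0z.
have b1E : b1%:~R = - (2 * A * x) by exact: Lv.
(* On a vertical line the coefficient [c] is unconstrained, so [c1 = 0] is allowed and [n] is [c]
   itself. The discriminant form is then affine in the slope, and a logarithm integrates its
   inverse. *)
exists a1, b1, 0, 0, 1, (fun t => A * (x ^+ 2 + t ^+ 2)),
  (fun s => (4 * A)^-1 * ln (- b1%:~R ^+ 2 + 4 * A * s)), (2 * A)^-1.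
have gE s : disc_form a1 b1 0 0 1 s = - b1%:~R ^+ 2 + 4 * A * s.
  by rewrite /disc_form -/A; ring.
split; last by rewrite mulr_ge0 ?addr_ge0 ?sqr_ge0 ?(ltW A0).
split => //.
- by rewrite invr_gt0 mulr_gt0.
- by move=> t _ /=; rewrite b1E; ring.
- by move=> t _ /=; ring.
- move=> t _ a b c /= Hb _; have [m [n [-> -> _]]] := Lspan a b 0 Hb.
  by exists m, c; split; ring.
- move=> t; rewrite /= in_itv /= andbT => t0.
  apply: is_derive_eq; rewrite /GRing.scale /= gE b1E; field.
  by rewrite !gt_eqF.
- move=> t; rewrite /= in_itv /= andbT => t0; rewrite gE.
  have g0 : 0 < - b1%:~R ^+ 2 + 4 * A * (A * (x ^+ 2 + t ^+ 2)).
    have -> : - b1%:~R ^+ 2 + 4 * A * (A * (x ^+ 2 + t ^+ 2)) = 4 * (A * t) ^+ 2.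
      by rewrite b1E; ring.
    by rewrite mulr_gt0 // exprn_gt0 // mulr_gt0.
  have h := is_derive_ln_affine g0.
  apply: is_derive_eq; rewrite /GRing.scale /=; field.
  by rewrite !gt_eqF.
Qed.

Lemma semicircle_chart q r (r0 : 0 < r) u :
  rational q -> rational (r ^+ 2) -> param_dom (Semicircle q r0) u ->
  exists a1 b1 c1 b2 c2 sigma H k,
    slope_chart (Semicircle q r0) a1 b1 c1 b2 c2 sigma H k /\ 0 <= sigma u.
Proof.
move=> [p _ qE] [p' _ rE] _.
have {}qE : q = (numq p)%:~R / (denq p)%:~R by rewrite -qE.
have [w wE] : exists w : rat, q ^+ 2 - r ^+ 2 = (numq w)%:~R / (denq w)%:~R.
  exists (p ^+ 2 - p'); rewrite -[RHS]/(ratr _) rmorphB rmorphXn /= rE.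
  by rewrite [ratr p]/ratr -qE.
set f : int := denq p in qE; set e : int := numq p in qE.
have f0 : 0 < f by exact: denq_gt0.
have F0 : 0 < f%:~R :> R by rewrite ltr0z.
have qF : q * f%:~R = e%:~R by rewrite qE divfK // gt_eqF.
set rho := q ^+ 2 - r ^+ 2 in wE.
(* On the circle [|z|^2 = 2 q Re z - rho], and a root of the form has [Re z = - b / (2 a)] and
   [|z|^2 = c / a]. For [a = 0] and [q = e / f] in lowest terms the solutions are the multiples of
   [(0, f, - e)]. *)
pose L (a b c : int) := c%:~R + q * b%:~R + rho * a%:~R = 0.
have [|||a1 [b1 [c1 [a10 Lv Lspan]]]] := @int_lattice_basis L f (- e).
- move=> k a b c a' b' c'; rewrite /L !rmorphB !rmorphM /= => h h'.
  transitivity ((c%:~R + q * b%:~R + rho * a%:~R) -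
    k%:~R * (c'%:~R + q * b'%:~R + rho * a'%:~R)); first by ring.
  by rewrite h h'; ring.
- move=> b c; rewrite /L mulr0 addr0 => h.
  have cf : c * f = - (e * b).
    apply: (@intr_inj R); rewrite rmorphM rmorphN rmorphM /= -qF.
    transitivity (f%:~R * (c%:~R + q * b%:~R) - q * f%:~R * b%:~R); first by ring.
    by rewrite h; ring.
  have /dvdzP[n bE] : (f %| b)%Z.
    have : (f %| e * b)%Z by apply/dvdzP; exists (- c); rewrite mulNr cf opprK.
    rewrite Gauss_dvdzr // coprimez_sym.
    exact: coprime_num_den.
  exists n; split => //; apply: (@mulIf _ f); first by rewrite gt_eqF.
  by rewrite cf bE; ring.
- exists (denq w), 0, (- numq w); split; first exact: denq_gt0.
  rewrite /L wE rmorphN /=; field.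
  by rewrite intr_eq0 denq_neq0.
set A : R := a1%:~R; have A0 : 0 < A by rewrite ltr0z.
pose X t : R := q + r * cos t.
(* Subtracting [k0] times [(0, f, - e)] from the first basis vector adds [k0] to the slope; this
   [k0] makes the slope at [u] nonnegative. *)
pose k0 : int := (Num.truncn `|(- (2 * A * X u) - b1%:~R) / f%:~R|).+1%:Z.
pose B : R := (b1 - k0 * f)%:~R.
have BE : B = b1%:~R - k0%:~R * f%:~R by rewrite /B rmorphB rmorphM.
have LC : (c1 + k0 * e)%:~R = - (q * B) - rho * A :> R.
  rewrite rmorphD rmorphM /= -qF BE.
  have /eqP := Lv; rewrite -addrA addr_eq0 => /eqP ->; rewrite -/A; ring.
exists a1, (b1 - k0 * f), (c1 + k0 * e), f, (- e), (fun t => (- (2 * A * X t) - B) / f%:~R),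
  (fun s => (4 * A * r * f%:~R)^-1 * (ln (2 * A * r + B + 2 * A * q + f%:~R * s)
      - ln (2 * A * r - B - 2 * A * q + (- f%:~R) * s))), (2 * A * r * f%:~R)^-1.
(* The two factors have constant sum [4 * A * r], so partial fractions of the inverse give the
   difference of logarithms chosen for [H]. At [sigma t] they equal [2 A r (1 - cos t)] and
   [2 A r (1 + cos t)], hence are positive. *)
have gE s : disc_form a1 (b1 - k0 * f) (c1 + k0 * e) f (- e) s
   = (2 * A * r + B + 2 * A * q + f%:~R * s) * (2 * A * r - B - 2 * A * q + (- f%:~R) * s).
  by rewrite /disc_form LC -/A -/B rmorphN /= -qF /rho; ring.
have sE t : f%:~R * ((- (2 * A * X t) - B) / f%:~R) = - (2 * A * X t) - B.
  by rewrite mulrC divfK // gt_eqF.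
have Ar0 : 0 < 2 * A * r by rewrite !mulr_gt0.
split.
  split => //.
  - by rewrite invr_gt0 mulr_gt0.
  - by rewrite gt_eqF.
  - move=> t _; rewrite ReIm_param_circle /= sE -/(X t) -/B; ring.
  - move=> t _; rewrite ReIm_param_circle /= LC -/A rmorphN /= -qF mulNr -(mulrA q) sE.
    rewrite exprMn /rho /X.
    have -> : sin t ^+ 2 = 1 - cos t ^+ 2 by rewrite sin2cos2.
    ring.
  - move=> t _ a b c; rewrite ReIm_param_circle /= => Hb Hc.
    have Labc : L a b c.
      rewrite /L Hb Hc /rho exprMn.
      have -> : sin t ^+ 2 = 1 - cos t ^+ 2 by rewrite sin2cos2.
      ring.
    have [m [n [-> -> ->]]] := Lspan _ _ _ Labc.
    by exists m, (n + m * k0); split; ring.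
  - move=> t; rewrite /= in_itv /= => /sin_gt0_pi s0.
    rewrite gE mulNr (sE t) /X.
    apply: is_derive_eq; rewrite /GRing.scale /=.
    have c2 : cos t ^+ 2 = 1 - sin t ^+ 2 by rewrite cos2sin2.
    transitivity (2 * A * r * sin t / f%:~R); first by field; rewrite gt_eqF.
    transitivity ((2 * A * r * f%:~R)^-1 * (sin t)^-1 * (4 * A ^+ 2 * r ^+ 2 * (1 - cos t ^+ 2))).
      by rewrite c2; field; rewrite !gt_eqF.
    by field; rewrite !gt_eqF.
  - move=> t; rewrite /= in_itv /= => tpi; have s0 := sin_gt0_pi tpi.
    have c1' : `|cos t| < 1.
      rewrite -[ltRHS]ger0_norm // -ltr_sqr ?nnegrE // !real_normK ?num_real //.
      rewrite cos2sin2 expr1n; have := exprn_gt0 2 s0; lra.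
    move: c1'; rewrite ltr_norml => /andP[cl cr].
    have g1 : 0 < 2 * A * r + B + 2 * A * q + f%:~R * ((- (2 * A * X t) - B) / f%:~R).
      rewrite (sE t) /X; have : 0 < 2 * A * r * (1 - cos t) by rewrite mulr_gt0 // subr_gt0.
      lra.
    have g2 : 0 < 2 * A * r - B - 2 * A * q + - f%:~R * ((- (2 * A * X t) - B) / f%:~R).
      rewrite mulNr (sE t) /X; have : 0 < 2 * A * r * (1 + cos t) by rewrite mulr_gt0 //; lra.
      lra.
    have d1 := is_derive_ln_affine g1; have d2 := is_derive_ln_affine g2.
    rewrite gE; apply: is_derive_eq; rewrite /GRing.scale /=.
    move: g1 g2 {d1 d2}; set S := (_ - B) / _.
    have : (2 * A * r + B + 2 * A * q + f%:~R * S) + (2 * A * r - B - 2 * A * q + - f%:~R * S)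
      = 4 * A * r by ring.
    move: (_ + f%:~R * S) (_ + - f%:~R * S) => P1 P2 P12 P10 P20.
    have -> : f%:~R / P1 - - f%:~R / P2 = f%:~R * (P1 + P2) / (P1 * P2).
      by field; rewrite !gt_eqF.
    by rewrite P12; field; rewrite !gt_eqF.
rewrite BE opprB addrCA addrC mulrDl mulfK ?gt_eqF //.
set y := _ / _; have : `|y| < k0%:~R by rewrite /k0 -pmulrn truncnS_gt.
by rewrite ltr_norml; lra.
Qed.

Lemma exists_slope_chart G u : rational_geodesic G -> param_dom G u ->
  exists a1 b1 c1 b2 c2 sigma H k,
    slope_chart G a1 b1 c1 b2 c2 sigma H k /\ 0 <= sigma u.
Proof.
case: G => [x|q r r0] /=; first exact: vertical_chart.
by case; exact: semicircle_chart.
Qed.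

End Chart.

Lemma FTC2_Rintegral (R : realType) (f F : R -> R) (u v : R) : u <= v ->
  (forall t, u <= t <= v -> {for t, continuous f}) ->
  (forall t, u <= t <= v -> is_derive t 1 F (f t)) ->
  \int[lebesgue_measure]_(t in `[u, v]) f t = F v - F u.
Proof.
rewrite le_eqVlt => /predU1P[<-|uv] cf dF.
  by rewrite set_itv1 Rintegral_set1 subrr.
have cF t : u <= t <= v -> {for t, continuous F}.
  move=> /dF dFt; apply: differentiable_continuous; apply/derivable1_diffP.
  exact: ex_derive.
have uvu : u <= u <= v by rewrite lexx ltW.
have uvv : u <= v <= v by rewrite lexx ltW.
rewrite /Rintegral (continuous_FTC2 (F := F)) //.
- apply/continuous_in_subspaceT => t; rewrite inE /= in_itv /= => /cf; exact.
- split.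
  + move=> t; rewrite in_itv /= => /andP[ut tv].
    by have /dF dFt : u <= t <= v by rewrite !ltW.
  + by apply: cvg_at_right_filter; exact: cF.
  + by apply: cvg_at_left_filter; exact: cF.
- move=> t; rewrite in_itv /= => /andP[ut tv].
  have /dF dFt : u <= t <= v by rewrite !ltW.
  by rewrite derive1E derive_val.
Qed.

(** * Arc length and CM points in slope coordinates *)

Section ChartTheory.
Variables (R : realType) (G : geodesic R) (a1 b1 c1 b2 c2 : int).
Variables (sigma H : R -> R) (k : R).
Hypothesis ch : slope_chart G a1 b1 c1 b2 c2 sigma H k.
Implicit Types (a b s t u v T : R) (m n B : nat).

Let g := @disc_form R a1 b1 c1 b2 c2.
Let a1_gt0 : 0 < a1%:~R :> R.
Proof. by rewrite ltr0z; exact: (chart_a_gt0 ch). Qed.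

Lemma disc_form_sigma t : param_dom G t ->
  g (sigma t) = 4 * a1%:~R ^+ 2 * complex.Im (param G t) ^+ 2.
Proof.
move=> Dt; rewrite /g /disc_form -(chart_norm ch Dt).
by rewrite -(chart_Re ch Dt); ring.
Qed.

Lemma disc_form_gt0 t : param_dom G t -> 0 < g (sigma t).
Proof.
move=> Dt; rewrite disc_form_sigma //.
by rewrite !mulr_gt0 // param_Im_gt0.
Qed.

Lemma sigma_continuous t : param_dom G t -> {for t, continuous sigma}.
Proof.
move=> Dt; have dt := chart_derive ch Dt.
by apply: differentiable_continuous; apply/derivable1_diffP; exact: ex_derive.
Qed.

Lemma sigma_lt t t' : param_dom G t -> param_dom G t' -> t < t' -> sigma t < sigma t'.
Proof.
move=> Dt Dt' tt'.
have D s : s \in `[t, t'] -> param_dom G s.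
  by rewrite in_itv /=; exact: param_dom_itv.
have dsigma s : s \in `]t, t'[ -> is_derive s 1 sigma (k * arc_speed G s * g (sigma s)).
  by move=> ss; apply: (chart_derive ch); apply: D;
    exact: subset_itv_oo_cc ss.
have [|s ss sE] := MVT tt' dsigma.
  by apply/continuous_in_subspaceT => s; rewrite inE /= => /D /sigma_continuous.
have Ds : param_dom G s by apply: D; exact: subset_itv_oo_cc ss.
rewrite -subr_gt0 sE; apply: mulr_gt0; last by rewrite subr_gt0.
rewrite !mulr_gt0 //.
- exact: (chart_k_gt0 ch).
- exact: arc_speed_gt0.
- exact: disc_form_gt0.
Qed.

Lemma sigma_le t t' : param_dom G t -> param_dom G t' -> t <= t' -> sigma t <= sigma t'.
Proof.
move=> Dt Dt'; rewrite le_eqVlt => /predU1P[->//|tt'].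
by apply: ltW; exact: sigma_lt.
Qed.

Lemma sigma_inj t t' : param_dom G t -> param_dom G t' -> sigma t = sigma t' -> t = t'.
Proof.
move=> Dt Dt' e; have [tt'|tt'|//] := ltgtP t t'.
  by have := sigma_lt Dt Dt' tt'; rewrite e ltxx.
by have := sigma_lt Dt' Dt tt'; rewrite e ltxx.
Qed.

Lemma sigma_onto u v s : param_dom G u -> param_dom G v -> u <= v ->
  sigma u <= s <= sigma v -> exists t, [/\ u <= t <= v, param_dom G t & sigma t = s].
Proof.
move=> Du Dv uv usv; have D t : u <= t <= v -> param_dom G t by exact: param_dom_itv.
have [||t tuv ts] := @IVT R sigma u v s uv.
- by apply/continuous_in_subspaceT => t; rewrite inE /= in_itv /= => /D /sigma_continuous.
- by rewrite min_l ?max_r // sigma_le.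
- by rewrite in_itv /= in tuv; exists t; split => //; exact: D.
Qed.

Lemma H_mean_value u v a b : param_dom G u -> param_dom G v -> u <= v ->
  sigma u <= a -> a <= b -> b <= sigma v ->
  exists2 s, a <= s <= b & H b - H a = (g s)^-1 * (b - a).
Proof.
move=> Du Dv uv ua ab bv.
have dH s : s \in `[a, b] -> is_derive s 1 H (g s)^-1.
  rewrite in_itv /= => /andP[as_ sb].
  have [|t [_ Dt <-]] := @sigma_onto u v s Du Dv uv; first by lra.
  exact: (chart_primitive ch Dt).
have dHo s : s \in `]a, b[ -> is_derive s 1 H ((fun x => (g x)^-1) s).
  by move=> /subset_itv_oo_cc /dH.
have cH : {within `[a, b], continuous H}.
  by apply: derivable_within_continuous => s /dH ds; exact: ex_derive.
have [s sab sE] := MVT_segment ab dHo cH.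
by rewrite in_itv /= in sab; exists s.
Qed.

(** By the chain rule the discriminant form cancels: [H (sigma t)] has derivative
    [k * arc_speed G t]. *)
Lemma hyp_length_arc u v : param_dom G u -> param_dom G v -> u <= v ->
  hyp_length G (param G @` `[u, v]) = (H (sigma v) - H (sigma u)) / k.
Proof.
move=> Du Dv uv; have D t : u <= t <= v -> param_dom G t by exact: param_dom_itv.
have k0 : 0 < k by exact: (chart_k_gt0 ch).
rewrite /hyp_length.
have -> : param_dom G `&` param G @^-1` (param G @` `[u, v]) = `[u, v]%classic.
  apply/seteqP; split => t /=; last first.
    by move=> tuv; split; [apply: D; rewrite in_itv in tuv|exists t].
  move=> [Dt [s suv st]].
  suff -> : t = s by [].
  have Ds : param_dom G s by apply: D; rewrite /= in_itv in suv.
  (* Equal points give equal [b2 * sigma] and equal [c2 * sigma], and one of [b2], [c2] is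
     nonzero. *)
  apply: sigma_inj => //.
  have := chart_Re ch Ds; have := chart_norm ch Ds.
  rewrite st (chart_Re ch Dt) (chart_norm ch Dt).
  move=> /addrI e1 /addrI e2.
  case/orP: (chart_nontrivial ch) => nz.
    by apply: mulfI e2; rewrite intr_eq0.
  by apply: mulfI e1; rewrite intr_eq0.
transitivity (\int[lebesgue_measure]_(t in `[u, v]) arc_speed G t).
  by apply: eq_Rintegral => t; rewrite inE /= in_itv /= => /D; exact: arc_speedE.
have cf t : u <= t <= v -> {for t, continuous (arc_speed G)}.
  by move=> /D; exact: arc_speed_continuous.
have dF t : u <= t <= v -> is_derive t 1 (fun t => k^-1 * H (sigma t)) (arc_speed G t).
  move=> /D Dt; have dH := chart_primitive ch Dt.
  have ds := chart_derive ch Dt.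
  have dHs := @is_derive1_comp R H sigma t _ _ dH ds.
  apply: is_derive_eq; rewrite /GRing.scale /= -/g.
  have := disc_form_gt0 Dt; move: (g _) (arc_speed _ _) => x y x0.
  by field; rewrite !gt_eqF.
by rewrite (FTC2_Rintegral uv cf dF) -mulrBr mulrC.
Qed.

(** The quadratic formula for the form of slope [s]; it gives the point from the slope without
    inverting [sigma]. *)
Definition chart_point s : R[i] :=
  (- (b1%:~R + b2%:~R * s) / (2 * a1%:~R)) +i* (Num.sqrt (g s) / (2 * a1%:~R)).

Lemma param_chart_point t : param_dom G t -> param G t = chart_point (sigma t).
Proof.
move=> Dt; rewrite /chart_point disc_form_sigma // -(chart_Re ch Dt).
have -> : 4 * a1%:~R ^+ 2 * complex.Im (param G t) ^+ 2
        = (2 * a1%:~R * complex.Im (param G t)) ^+ 2 by ring.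
rewrite sqrtr_sqr gtr0_norm; last by rewrite !mulr_gt0 // param_Im_gt0.
case: (param G t) => x y /=; congr (_ +i* _); field; exact: lt0r_neq0.
Qed.

Lemma CM_root (a x y : R) :
  a%:C * (x +i* y) ^+ 2 + (- (2 * a * x))%:C * (x +i* y) + (a * (x ^+ 2 + y ^+ 2))%:C = 0.
Proof.
rewrite expr2; simpc; apply/eqP; rewrite eq_complex /=.
by apply/andP; split; apply/eqP; ring.
Qed.

Lemma normalizedP (f : bqf) : disc f < 0 ->
  normalized f = (gcdz (qa f) (gcdz (qb f) (qc f)) == 1) && (0 < qa f).
Proof.
case: f => a b c; rewrite /disc /normalized /= => D0; congr (_ && _).
have [_|_|a0] := ltgtP 0 a => //; rewrite ?andbF //.
by move: D0; rewrite -a0 mulr0 mul0r subr0 ltNge sqr_ge0.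
Qed.

(** The coordinates [m], [n] of the form of [z] in the lattice basis satisfy [n = m * sigma t], with
    [m > 0] since [a > 0]. A common divisor of [m] and [n] divides all three coefficients, so they
    are coprime. *)
Lemma arc_CM_point u v T z : param_dom G u -> param_dom G v -> u <= v -> 0 <= sigma u ->
  (param G @` `[u, v] `&` CM G T) z ->
  exists m n, sector (fun s => (g s)^-1) (sigma u) (sigma v) T m n && coprime m n /\
    z = chart_point (n%:R / m%:R).
Proof.
move=> Du Dv uv su0 [[t /= tuv tz] [_ [_ [f [nf D0 <- z0 fz]] DT]]].
rewrite in_itv /= in tuv; have Dt : param_dom G t by exact: param_dom_itv tuv.
have Hg := disc_form_sigma Dt; have Hg0 := disc_form_gt0 Dt.
have HRe := chart_Re ch Dt.
have Hn := chart_norm ch Dt.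
have Hsp := chart_span ch Dt.
have stv : sigma u <= sigma t <= sigma v.
  by case/andP: tuv => ut tv; rewrite !sigma_le.
have zE := param_chart_point Dt.
rewrite normalizedP // in nf; case/andP: nf => /eqP gcd1 qa0.
rewrite -tz /halfplane /= in z0 fz *.
case E : (param G t) => [x y] /=; rewrite E /= in Hg HRe Hn Hsp z0 fz.
have [_ Hb Hc HD] := CM_coef z0 D0 fz.
have [m [n [aE bE cE]]] := Hsp _ _ _ Hb Hc.
have m0 : 0 < m by move: qa0; rewrite aE pmulr_lgt0 // (chart_a_gt0 ch).
have nE : n%:~R = m%:~R * sigma t :> R.
  move: Hb Hc; rewrite aE bE cE !rmorphD !rmorphM /=.
  have -> : - (2 * (m%:~R * a1%:~R) * x) = m%:~R * - (2 * a1%:~R * x) :> R by ring.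
  rewrite -(mulrA m%:~R) HRe Hn !mulrDr.
  move=> /addrI e2 /addrI e1.
  case/orP: (chart_nontrivial ch) => nz.
    by apply: (@mulIf R b2%:~R); rewrite ?intr_eq0 // e2; ring.
  by apply: (@mulIf R c2%:~R); rewrite ?intr_eq0 // e1; ring.
have m0R : 0 < m%:~R :> R by rewrite ltr0z.
have n0 : 0 <= n.
  rewrite -(ler0z R) nE mulr_ge0 ?(ltW m0R) //; lra.
case: m m0 aE bE cE nE m0R => // m m0 aE bE cE nE m0R.
case: n n0 bE cE nE => // n _ bE cE nE.
rewrite -!pmulrn in nE m0R.
have nmE : n%:R / m%:R = sigma t by rewrite nE mulrC mulKf // gt_eqF.
exists m, n; split; last by rewrite nmE -zE.
apply/andP; split.
  apply/and3P; split => //; first by rewrite nE !(mulrC m%:R) !ler_pM2r.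
  rewrite nmE ler_pdivlMr //; apply: le_trans DT.
  have -> : `|disc f|%:~R = m%:R ^+ 2 * g (sigma t); last by [].
  rewrite Hg intr_norm HD normrN ger0_norm; last first.
    by rewrite mulr_ge0 ?sqr_ge0 // mulr_ge0 ?sqr_ge0.
  by rewrite aE rmorphM /= -pmulrn; ring.
have : (Posz (gcdn m n) %| gcdz (qa f) (gcdz (qb f) (qc f)))%Z.
  have dm : (Posz (gcdn m n) %| Posz m)%Z by rewrite dvdzE /= dvdn_gcdl.
  have dn : (Posz (gcdn m n) %| Posz n)%Z by rewrite dvdzE /= dvdn_gcdr.
  by rewrite !dvdz_gcd aE bE cE dvdz_mulr // !rpredD // dvdz_mulr.
by rewrite gcd1 dvdzE /= dvdn1.
Qed.

(** Normalization is the delicate point: dividing the form by the gcd [d] of its coefficients leaves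
    an integer form with the same root. By [chart_span] this has integer coordinates too, so [d]
    divides both [m] and [n]. *)
Lemma chart_point_CM u v T m n : param_dom G u -> param_dom G v -> u <= v ->
  sector (fun s => (g s)^-1) (sigma u) (sigma v) T m n -> coprime m n ->
  (param G @` `[u, v] `&` CM G T) (chart_point (n%:R / m%:R)).
Proof.
move=> Du Dv uv /and3P[m0 mn mT] cop.
have [t [tuv Dt tE]] := sigma_onto Du Dv uv (slope_itv m0 mn).
rewrite -tE -param_chart_point //; split; first by exists t => //=; rewrite in_itv.
split; first by exists t.
have Hg := disc_form_sigma Dt; have Hg0 := disc_form_gt0 Dt.
have HRe := chart_Re ch Dt.
have Hn := chart_norm ch Dt.
have Hsp := chart_span ch Dt.
have y0 := param_Im_gt0 Dt.
have m0R : 0 < m%:R :> R by rewrite ltr0n.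
have nE : n%:R = m%:R * sigma t by rewrite tE mulrC divfK // gt_eqF.
case E : (param G t) => [x y]; rewrite E /= in Hg HRe Hn Hsp y0.
pose a := m%:Z * a1; pose b := m%:Z * b1 + n%:Z * b2; pose c := m%:Z * c1 + n%:Z * c2.
have aR : a%:~R = m%:R * a1%:~R :> R by rewrite rmorphM /= -pmulrn.
have bR : b%:~R = - (2 * a%:~R * x) :> R.
  rewrite aR rmorphD !rmorphM /= -!pmulrn nE.
  transitivity (m%:R * - (2 * a1%:~R * x)); last by ring.
  by rewrite HRe; ring.
have cR : c%:~R = a%:~R * (x ^+ 2 + y ^+ 2) :> R.
  by rewrite aR rmorphD !rmorphM /= -!pmulrn nE -mulrA Hn; ring.
have DR : (disc (BQF a b c))%:~R = - (m%:R ^+ 2 * g (sigma t)) :> R.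
  by rewrite Hg /disc /= rmorphB !(rmorphXn, rmorphM) /= bR cR aR; ring.
have D0 : disc (BQF a b c) < 0.
  by rewrite -(ltrz0 R) DR oppr_lt0 mulr_gt0 // exprn_gt0.
have a0 : 0 < a by rewrite mulr_gt0 ?(chart_a_gt0 ch) //; lia.
exists (disc (BQF a b c)); last first.
  rewrite intr_norm DR normrN ger0_norm.
    by move: mT; rewrite -tE ler_pdivlMr.
  by rewrite mulr_ge0 ?sqr_ge0 // ltW.
exists (BQF a b c); split => //=; last first.
  have toC (i : int) : i%:~R = (i%:~R : R)%:C :> R[i] by rewrite rmorph_int.
  by rewrite !toC bR cR CM_root.
rewrite normalizedP //= a0 andbT; set d := gcdz _ _.
have d0 : d != 0 by rewrite /d gcdz_eq0 gt_eqF.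
have [/dvdzP[a' aE] /dvdzP[b' bE] /dvdzP[c' cE]] : [/\ (d %| a)%Z, (d %| b)%Z & (d %| c)%Z].
  have := dvdz_gcdr a (gcdz b c); rewrite -/d dvdz_gcd => /andP[db dc].
  by split => //; exact: dvdz_gcdl.
have dR : d%:~R != 0 :> R by rewrite intr_eq0.
have [m' [n' [a'E b'E c'E]]] : exists m n : int,
    [/\ a' = m * a1, b' = m * b1 + n * b2 & c' = m * c1 + n * c2].
  apply: Hsp; apply: (mulIf dR).
    by rewrite -rmorphM /= -bE bR aE rmorphM /=; ring.
  by rewrite -rmorphM /= -cE cR aE rmorphM /=; ring.
have mE : m%:Z = m' * d.
  apply: (@mulIf _ a1); first by rewrite gt_eqF // (chart_a_gt0 ch).
  by rewrite -/a aE a'E; ring.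
have nE' : n%:Z = n' * d.
  have e1 : n%:Z * b2 = n' * d * b2.
    have : m%:Z * b1 + n%:Z * b2 = (m' * b1 + n' * b2) * d by rewrite -b'E -bE.
    by rewrite mE; lia.
  have e2 : n%:Z * c2 = n' * d * c2.
    have : m%:Z * c1 + n%:Z * c2 = (m' * c1 + n' * c2) * d by rewrite -c'E -cE.
    by rewrite mE; lia.
  by case/orP: (chart_nontrivial ch) => nz;
    [exact: mulIf e1 | exact: mulIf e2].
have : (d %| gcdz m n)%Z by rewrite dvdz_gcd mE nE' !dvdz_mull.
have d_ge0 : 0 <= d by [].
rewrite /gcdz /= (eqP cop) dvdzE dvdn1; lia.
Qed.

Lemma chart_point_inj u v m n m' n' : param_dom G u -> param_dom G v -> u <= v ->
  (0 < m)%N -> (0 < m')%N -> coprime m n -> coprime m' n' ->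
  sigma u <= n%:R / m%:R <= sigma v -> sigma u <= n'%:R / m'%:R <= sigma v ->
  chart_point (n%:R / m%:R) = chart_point (n'%:R / m'%:R) -> (m, n) = (m', n').
Proof.
move=> Du Dv uv m0 m0' cop cop' /(sigma_onto Du Dv uv)[t [_ Dt tE]].
move=> /(sigma_onto Du Dv uv)[t' [_ Dt' tE']].
rewrite -tE -tE' -!param_chart_point // => e.
have st : sigma t = sigma t'.
  have := chart_Re ch Dt; have := chart_norm ch Dt.
  rewrite e (chart_Re ch Dt') (chart_norm ch Dt').
  move=> /addrI e1 /addrI e2.
  case/orP: (chart_nontrivial ch) => nz.
    by apply: mulfI (esym e2); rewrite intr_eq0.
  by apply: mulfI (esym e1); rewrite intr_eq0.
have nm : (n * m' = n' * m)%N.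
  apply/eqP; rewrite -(eqr_nat R) !natrM -eqr_div ?pnatr_eq0 -?lt0n //.
  by rewrite -tE -tE' st.
have mm : m = m'.
  apply/eqP; rewrite eqn_dvd; apply/andP; split.
    by rewrite -(Gauss_dvdr _ cop) nm dvdn_mull.
  by rewrite -(Gauss_dvdr _ cop') -nm dvdn_mull.
by move: nm; rewrite mm => /eqP; rewrite eqn_pmul2r // => /eqP ->.
Qed.

End ChartTheory.

(** * Equidistribution *)

Lemma box_count_size (R : realType) (B : nat) (phi : nat -> nat -> bool) :
  box_count R B phi =
  (size [seq p <- [seq (m, n) | m <- index_iota 0 B, n <- index_iota 0 B] | phi p.1 p.2])%:R.
Proof.
rewrite size_filter -sum1_count big_mkcond big_allpairs_dep /= natr_sum.
apply: eq_bigr => m _; rewrite natr_sum; apply: eq_bigr => n _.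
by case: (phi m n).
Qed.

Lemma numpts_box_count (R : realType) (A : set R[i]) (F : nat -> nat -> R[i]) B
    (phi : nat -> nat -> bool) :
  (forall m n, phi m n -> (m < B)%N /\ (n < B)%N) ->
  (forall z, A z -> exists m n, phi m n /\ z = F m n) ->
  (forall m n, phi m n -> A (F m n)) ->
  (forall m n m' n', phi m n -> phi m' n' -> F m n = F m' n' -> (m, n) = (m', n')) ->
  numpts A = box_count R B phi.
Proof.
move=> phiB AF FA Finj; rewrite box_count_size.
set s := [seq p <- _ | _].
have sP m n : ((m, n) \in s) = phi m n.
  rewrite mem_filter /=; case: (boolP (phi m n)) => //= /phiB[mB nB].
  by apply/allpairsP; exists (m, n); rewrite !mem_index_iota.
have s_uniq : uniq s.
  by apply: filter_uniq; apply: allpairs_uniq; rewrite ?iota_uniq // => -[? ?] [? ?].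
(* Presenting [A] as a finite set keeps [fset_set] away from its empty default. *)
have -> : A = [set` [fset z in [seq F p.1 p.2 | p <- s]]%fset].
  apply/seteqP; split => z /=.
    by move=> /AF[m [n [mn ->]]]; rewrite inE; apply/mapP; exists (m, n); rewrite ?sP.
  by rewrite inE => /mapP[[m n]]; rewrite sP => /FA Amn ->.
rewrite /numpts set_fsetK card_fseq undup_id ?size_map // map_inj_in_uniq //.
by move=> [m n] [m' n']; rewrite !sP; exact: Finj.
Qed.

Lemma disc_form_inv_lipschitz (R : realType) (a1 b1 c1 b2 c2 : int) (lo hi : R) :
  0 <= lo -> lo <= hi ->
  (forall s, lo <= s <= hi -> 0 < @disc_form R a1 b1 c1 b2 c2 s) ->
  exists W K, [/\ 0 <= K,
    forall s, lo <= s <= hi -> 0 <= (@disc_form R a1 b1 c1 b2 c2 s)^-1 <= W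
    & forall s t, lo <= s <= hi -> lo <= t <= hi ->
    `|(@disc_form R a1 b1 c1 b2 c2 s)^-1 - (@disc_form R a1 b1 c1 b2 c2 t)^-1|
      <= K * `|s - t|].
Proof.
move=> lo0 lohi; set g := @disc_form R _ _ _ _ _ => g_gt0.
have cg : {within `[lo, hi], continuous g}.
  apply: derivable_within_continuous => s _; rewrite /g /disc_form.
  exact: ex_derive.
have [x] := EVT_min lohi cg; rewrite in_itv /= => xI gmin.
have gx0 := g_gt0 x xI.
have gx s : lo <= s <= hi -> g x <= g s by move=> sI; apply: gmin; rewrite in_itv.
(* Bounds the difference quotient of the quadratic [g], which is affine in [s + t], with
   [0 <= s + t <= 2 * hi]. Dividing by the squared minimum of [g] gives the Lipschitz constant of
   [1 / g]. *)
pose M : R := `|4 * a1%:~R * c2%:~R - 2 * b1%:~R * b2%:~R| + b2%:~R ^+ 2 * (2 * hi).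
have M0 : 0 <= M by rewrite addr_ge0 // mulr_ge0 ?sqr_ge0 //; lra.
exists (g x)^-1, (M / g x ^+ 2); split.
- by rewrite divr_ge0 ?sqr_ge0.
- move=> s sI; have gs := gx s sI; have gs0 := g_gt0 s sI.
  by rewrite invr_ge0 (ltW gs0) lef_pV2.
- move=> s t sI tI; have gs := gx s sI; have gt := gx t tI.
  have gs0 := g_gt0 s sI; have gt0 := g_gt0 t tI.
  have -> : (g s)^-1 - (g t)^-1 = (g t - g s) / (g s * g t).
    by move: (g s) (g t) gs0 gt0 => y z y0 z0; field; rewrite !gt_eqF.
  have -> : g t - g s = (4 * a1%:~R * c2%:~R - 2 * b1%:~R * b2%:~R
      - b2%:~R ^+ 2 * (s + t)) * (t - s) by rewrite /g /disc_form; ring.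
  rewrite normrM normfV normrM (distrC t s) mulrAC ler_wpM2r //.
  have gg0 : 0 < g s * g t by exact: mulr_gt0.
  rewrite (gtr0_norm gg0); apply: ler_pM => //.
  + by rewrite invr_ge0 ltW.
  + rewrite (le_trans (ler_normB _ _)) // lerD2l normrM ger0_norm ?sqr_ge0 //.
    rewrite ler_wpM2l ?sqr_ge0 // ger0_norm; lra.
  + by rewrite lef_pV2 ?posrE ?exprn_gt0 // expr2 ler_pM // ltW.
Qed.

Unset Implicit Arguments.

Theorem theorem1p1 (R : realType) (G : geodesic R) (J1 J2 : set R[i]) :
  rational_geodesic G ->
  compact_subarc G J1 -> compact_subarc G J2 -> J1 `<=` J2 ->
  hyp_length G J2 != 0 ->
  numpts (J1 `&` CM G Delta) / numpts (J2 `&` CM G Delta) @[Delta --> +oo]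
    --> hyp_length G J1 / hyp_length G J2.
Proof.
move=> Grat [u1 [v1 [uv1 D1 ->]]] [u2 [v2 [uv2 D2 ->]]] _.
have endpoints u v : u <= v -> `[u, v] `<=` param_dom G -> param_dom G u /\ param_dom G v.
  by move=> uv D; split; apply: D; rewrite /= in_itv /= lexx uv.
have [Du1 Dv1] := endpoints _ _ uv1 D1; have [Du2 Dv2] := endpoints _ _ uv2 D2.
(* Both counts must come from one chart and one weight, hence a common parameter interval; the chart
   is normalized at its left end. *)
pose u := Num.min u1 u2; pose v := Num.max v1 v2.
have Du : param_dom G u by rewrite /u; case: (leP u1 u2).
have Dv : param_dom G v by rewrite /v; case: (leP v1 v2).
have uu1 : u <= u1 by rewrite ge_min lexx.
have uu2 : u <= u2 by rewrite ge_min lexx orbT.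
have vv1 : v1 <= v by rewrite le_max lexx.
have vv2 : v2 <= v by rewrite le_max lexx orbT.
have uv : u <= v by rewrite (le_trans uu1) // (le_trans uv1).
have [a1 [b1 [c1 [b2 [c2 [sigma [H [k [ch su0]]]]]]]]] := exists_slope_chart Grat Du.
have k0 := chart_k_gt0 ch.
pose g := @disc_form R a1 b1 c1 b2 c2; pose w s := (g s)^-1.
have [|W [K [K0 wW wK]]] :=
    @disc_form_inv_lipschitz R a1 b1 c1 b2 c2 _ _ su0 (sigma_le ch Du Dv uv).
  move=> s /(sigma_onto ch Du Dv uv)[t [_ Dt <-]].
  exact: (disc_form_gt0 ch).
have mean a b (ua : sigma u <= a) (ab : a <= b) (bv : b <= sigma v) :=
  H_mean_value ch Du Dv uv ua ab bv.
rewrite !(hyp_length_arc ch) // => H2.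
have count u' v' T : param_dom G u' -> param_dom G v' -> u <= u' -> u' <= v' -> v' <= v ->
    0 < T -> numpts (param G @` `[u', v'] `&` CM G T) =
    primitive_count w (sigma u) (sigma v) W K (sigma u') (sigma v') T.
  move=> Du' Dv' uu' uv' vv' T0.
  have su'0 : 0 <= sigma u' by rewrite (le_trans su0) // (sigma_le ch).
  apply: (@numpts_box_count _ _
    (fun m n => @chart_point R a1 b1 c1 b2 c2 (n%:R / m%:R))).
  - move=> m n /andP[mn _]; exact: (sector_box su0 (sigma_le ch Du Dv uv) wW K0
      (sigma_le ch Du Du' uu') (sigma_le ch Dv' Dv vv') (ltW T0) mn).
  - by move=> z; apply: (arc_CM_point ch).
  - by move=> m n /andP[mn cop]; exact: (chart_point_CM ch).
  - move=> m n m' n' /andP[/and3P[m0 mn _] cop] /andP[/and3P[m0' mn' _] cop'].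
    by apply: (chart_point_inj ch Du' Dv') => //; exact: slope_itv.
(* The nonzero length excludes equality, and the mean value form with [w >= 0] fixes the sign. *)
have H2' : H (sigma u2) < H (sigma v2).
  have [|||s s2 HE] := mean (sigma u2) (sigma v2); rewrite ?(sigma_le ch) //.
  rewrite -subr_gt0 lt0r; apply/andP; split.
    by apply: contra H2 => /eqP ->; rewrite mul0r.
  rewrite HE mulr_ge0 ?subr_ge0 ?(sigma_le ch) //.
  have [|h _] := andP (wW s _); last exact: h.
  by case/andP: s2 => h1 h2; rewrite (le_trans _ h1) ?(sigma_le ch) // (le_trans h2) // (sigma_le ch).
have -> : (H (sigma v1) - H (sigma u1)) / k / ((H (sigma v2) - H (sigma u2)) / k) =
    (H (sigma v1) - H (sigma u1)) / (H (sigma v2) - H (sigma u2)).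
  by field; rewrite (gt_eqF k0) subr_eq0 (gt_eqF H2').
have lim := primitive_count_ratio su0 (sigma_le ch Du Dv uv) wW K0 wK mean
  (sigma_le ch Du Du1 uu1) (sigma_le ch Du1 Dv1 uv1) (sigma_le ch Dv1 Dv vv1)
  (sigma_le ch Du Du2 uu2) (sigma_le ch Du2 Dv2 uv2) (sigma_le ch Dv2 Dv vv2) H2'.
apply/cvgrPdist_le => e e0; have [T0 HT] := lim e e0.
near=> T.
have Tpos : 0 < T by near: T; exact: nbhs_pinfty_gt.
rewrite !count // distrC; apply: HT.
by near: T; apply: nbhs_pinfty_ge; exact: num_real.
Unshelve. all: by end_near.
Qed.
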